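(* Let $p$ be a prime. The following assertion is false: ''For every $p$-adic Lie group $G$, there are closed normal subgroups $Z\subseteq K$ of $G$ such that $Z$ is abelian, $K/Z$ is discrete, and $G/K$ is isomorphic to a subgroup of $\mathrm{GL}_d(\mathbb{Q}_p)$, where $d=\dim(G)$.'' More precisely, the group $$G:=\bigcup_{n\in\mathbb{N}_0}\bigl(\mathbb{Q}_p*_{\mathbb{Z}_p}\mathbb{Q}_p*_{p\mathbb{Z}_p}\cdots*_{p^n\mathbb{Z}_p}\mathbb{Q}_p\bigr),$$ with the $1$-dimensional $p$-adic Lie group structure described in the context, does not have closed normal subgroups $Z\subseteq K$ with these properties (where $d=1$).
   Context: $\mathbb{N}_0=\{0,1,2,\dots\}$. For groups $A_1,A_2$ with a common subgroup $B$, $A_1*_BA_2$ denotes the free product of $A_1$ and $A_2$ with amalgamated subgroup $B$ (the pushout of the inclusions $B\to A_1$, $B\to A_2$ in the category of groups); $A_1$ and $A_2$ are regarded as subgroups of it, with $A_1\cap A_2=B$. The iterated amalgamated products are defined recursively: $G_0:=\mathbb{Q}_p$ (additive group), and for $n\ge 1$, $G_n:=G_{n-1}*_{p^{n-1}\mathbb{Z}_p}\mathbb{Q}_p$, where the new factor is a further copy of $\mathbb{Q}_p$, and $p^{n-1}\mathbb{Z}_p$ is a subgroup of the new factor in the obvious way and a subgroup of $G_{n-1}$ via its inclusion in the last copy of $\mathbb{Q}_p$ used in forming $G_{n-1}$ (for $n=1$: in $G_0=\mathbb{Q}_p$). Thus $G_{n+1}=\mathbb{Q}_p*_{\mathbb{Z}_p}\mathbb{Q}_p*_{p\mathbb{Z}_p}\cdots*_{p^n\mathbb{Z}_p}\mathbb{Q}_p$,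 $G_0\subseteq G_1\subseteq\cdots$, and $G=\bigcup_{n}G_n$ (direct limit). Lie group structure: $G_0=\mathbb{Q}_p$ has its usual structure; for $n\ge 1$, $p^{n-1}\mathbb{Z}_p$ is a central subgroup of $G_n$, and $G_n$ is given the unique $p$-adic Lie group structure turning $p^{n-1}\mathbb{Z}_p$ (with its usual structure) into an open Lie subgroup of $G_n$. Then $G_{n-1}$ is an open Lie subgroup of $G_n$, and $G$ is given the unique $p$-adic Lie group structure making each $G_n$ an open Lie subgroup. $p$-adic Lie groups are finite-dimensional analytic Lie groups over $\mathbb{Q}_p$. *)

(* Defs.v *)
From HB Require Import structures.
From mathcomp Require Import all_boot all_order all_algebra finmap.
From mathcomp Require Import all_classical topology.
From mathcomp Require Import summability.

Set Implicit Arguments.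
Unset Strict Implicit.
Unset Printing Implicit Defensive.

Import GRing.Theory.
Local Open Scope classical_set_scope.
Local Open Scope ring_scope.

(* The ring of p-adic integers is the inverse limit of the rings Z/p^n, an
   element being given by its least non-negative residues modulo the p^n. *)
Record padic_int (p : nat) (p_pr : prime p) := PadicInt {
  residue : nat -> nat;
  residueP : forall n, (residue n.+1 %% p ^ n)%N = residue n }.

Section PadicIntRing.
Variables (p : nat) (p_pr : prime p).
Local Notation Zp := (padic_int p_pr).
Implicit Types x y z : Zp.

HB.instance Definition _ := gen_eqMixin Zp.
HB.instance Definition _ := gen_choiceMixin Zp.

Lemma padic_intP x y : residue x =1 residue y -> x = y.
Proof.
case: x y => [x Px] [y Py] /= /funext exy; move: exy Px Py => -> Px Py.
by congr PadicInt; apply: Prop_irrelevance.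
Qed.

Lemma modn_pow m n : (m %% p ^ n.+1 = m %[mod p ^ n])%N.
Proof. by rewrite modn_dvdm // dvdn_exp2l. Qed.

Lemma residue_mod x n : (residue x n %% p ^ n)%N = residue x n.
Proof. by rewrite -{1}residueP modn_mod residueP. Qed.

Lemma residueS x n : (residue x n.+1 = residue x n %[mod p ^ n])%N.
Proof. by rewrite residueP residue_mod. Qed.

Lemma residue_add x n k : (residue x (n + k) = residue x n %[mod p ^ n])%N.
Proof.
elim: k => [|k IHk]; first by rewrite addn0.
rewrite -IHk addnS -(residueP x (n + k)).
by rewrite modn_dvdm // dvdn_exp2l // leq_addr.
Qed.

Lemma padic_ofP (f : nat -> nat) :
  (forall n, (f n.+1 = f n %[mod p ^ n])%N) ->
  forall n, ((f n.+1 %% p ^ n.+1) %% p ^ n)%N = (f n %% p ^ n)%N.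
Proof. by move=> fP n; rewrite modn_pow. Qed.

Definition padic_of (f : nat -> nat)
    (fP : forall n, (f n.+1 = f n %[mod p ^ n])%N) : Zp :=
  PadicInt p_pr (padic_ofP fP).

Lemma padic_addP x y n :
  (residue x n.+1 + residue y n.+1 = residue x n + residue y n %[mod p ^ n])%N.
Proof. by rewrite -modnDm !residueS modnDm. Qed.

Lemma padic_mulP x y n :
  (residue x n.+1 * residue y n.+1 = residue x n * residue y n %[mod p ^ n])%N.
Proof. by rewrite -modnMm !residueS modnMm. Qed.

Lemma padic_oppP x n : ((p ^ n.+1).-1 * residue x n.+1
  = (p ^ n).-1 * residue x n %[mod p ^ n])%N.
Proof.
have pn k : (0 < p ^ k)%N by rewrite expn_gt0 prime_gt0.
rewrite -modnMm residueS modnMm; apply/eqP.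
rewrite -(eqn_modDr (residue x n)) -!mulSnr !prednK //.
by rewrite modnMr expnS -mulnA mulnCA modnMr.
Qed.

Definition padic_const (k : nat) : Zp := @padic_of (fun=> k) (fun=> erefl).
Definition padic_add x y : Zp := padic_of (padic_addP x y).
Definition padic_mul x y : Zp := padic_of (padic_mulP x y).
Definition padic_opp x : Zp := padic_of (padic_oppP x).

Lemma padic_addA : associative padic_add.
Proof. by move=> x y z; apply: padic_intP => n /=; rewrite modnDml modnDmr addnA. Qed.

Lemma padic_addC : commutative padic_add.
Proof. by move=> x y; apply: padic_intP => n /=; rewrite addnC. Qed.

Lemma padic_add0 : left_id (padic_const 0) padic_add.
Proof.
by move=> x; apply: padic_intP => n /=; rewrite mod0n add0n residue_mod.
Qed.

Lemma padic_addN : left_inverse (padic_const 0) padic_opp padic_add.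
Proof.
move=> x; apply: padic_intP => n /=.
rewrite modnDml -mulSnr prednK ?expn_gt0 ?prime_gt0 //.
by rewrite modnMr mod0n.
Qed.

HB.instance Definition _ := GRing.isZmodule.Build Zp
  padic_addA padic_addC padic_add0 padic_addN.

Lemma padic_mulA : associative padic_mul.
Proof. by move=> x y z; apply: padic_intP => n /=; rewrite modnMml modnMmr mulnA. Qed.

Lemma padic_mulC : commutative padic_mul.
Proof. by move=> x y; apply: padic_intP => n /=; rewrite mulnC. Qed.

Lemma padic_mul1 : left_id (padic_const 1) padic_mul.
Proof.
by move=> x; apply: padic_intP => n /=; rewrite modnMml mul1n residue_mod.
Qed.

Lemma padic_mulDl : left_distributive padic_mul padic_add.
Proof.
move=> x y z; apply: padic_intP => n /=.
by rewrite modnMml modnDm mulnDl.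
Qed.

Lemma padic_1neq0 : padic_const 1 != padic_const 0.
Proof.
apply/eqP => /(congr1 (fun x => residue x 1)) /=.
by rewrite expn1 mod0n modn_small // prime_gt1.
Qed.

HB.instance Definition _ := GRing.Zmodule_isComNzRing.Build Zp
  padic_mulA padic_mulC padic_mul1 padic_mulDl padic_1neq0.

Definition padic_unit : {pred Zp} := fun x => `[< exists y, y * x = 1 >].
Definition padic_inv x : Zp := xget x [set y | y * x = 1].

Lemma padic_mulVx : {in padic_unit, left_inverse 1 padic_inv *%R}.
Proof.
move=> x; rewrite inE => -[z zx].
have yx : exists y, [set y | y * x = 1] y by exists z.
exact: (xgetPex x yx).
Qed.

Lemma padic_unitP x y : y * x = 1 -> padic_unit x.
Proof. by move=> xy; apply/asboolP; exists y. Qed.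

Lemma padic_inv_out : {in [predC padic_unit], padic_inv =1 id}.
Proof.
move=> x nx; apply: xgetPN => y yx.
by move/negP: nx; apply; apply/asboolP; exists y.
Qed.

HB.instance Definition _ := GRing.ComNzRing_hasMulInverse.Build Zp
  padic_mulVx padic_unitP padic_inv_out.

Lemma padic_neq0 x : x != 0 -> exists n, residue x n != 0%N.
Proof.
move=> /eqP xn0; apply: contrapT => /forallNP x0; apply: xn0.
apply: padic_intP => n /=; rewrite mod0n; apply/eqP.
by apply: contrapT => /negP; apply: x0.
Qed.

Lemma padic_logn x m k : residue x m != 0%N ->
  residue x (m + k) != 0%N /\ (logn p (residue x (m + k)) < m)%N.
Proof.
move=> xm; have xmk : ~~ (p ^ m %| residue x (m + k))%N.
  by rewrite /dvdn residue_add residue_mod.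
have xmk0 : residue x (m + k) != 0%N by apply: contraNneq xmk => ->.
by split=> //; rewrite ltnNge -pfactor_dvdn ?lt0n.
Qed.

Lemma padic_integral x y : x * y = 0 -> (x == 0) || (y == 0).
Proof.
move=> xy0; apply/negPn/negP; rewrite negb_or.
case/andP=> /padic_neq0[m xm] /padic_neq0[n yn].
have [x0 xl] := padic_logn n xm.
have := padic_logn m yn; rewrite addnC => -[y0 yl].
move/(congr1 (fun x => residue x (m + n))): xy0 => /= /eqP.
rewrite mod0n -/(dvdn _ _) pfactor_dvdn ?muln_gt0 ?lt0n ?x0 ?y0 //.
by rewrite lognM ?lt0n // leqNgt -addnS leq_add // ltnW.
Qed.

HB.instance Definition _ := GRing.ComUnitRing_isIntegral.Build Zp padic_integral.

End PadicIntRing.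

Definition padic (p : nat) (p_pr : prime p) : Type := {fraction padic_int p_pr}.
HB.instance Definition _ p (p_pr : prime p) := GRing.Field.on (padic p_pr).

(* The subgroup p^n Z_p of Q_p. *)
Definition pnZp p (p_pr : prime p) (n : nat) : set (padic p_pr) :=
  [set p%:R ^+ n * (@tofrac (padic_int p_pr) z) | z in [set: padic_int p_pr]].
Arguments pnZp {p} p_pr n _.

Section PadicTopology.
Variables (p : nat) (p_pr : prime p).
Local Notation Qp := (padic p_pr).
Implicit Types (x y : Qp) (U V : set Qp).

Lemma pnZp0 n : pnZp p_pr n 0.
Proof. by exists 0 => //; rewrite rmorph0 mulr0. Qed.

Lemma pnZpD n x y : pnZp p_pr n x -> pnZp p_pr n y -> pnZp p_pr n (x + y).
Proof.
by move=> [a _ <-] [b _ <-]; exists (a + b) => //; rewrite rmorphD mulrDr.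
Qed.

Lemma pnZpN n x : pnZp p_pr n x -> pnZp p_pr n (- x).
Proof. by move=> [a _ <-]; exists (- a) => //; rewrite rmorphN mulrN. Qed.

Lemma pnZp_le m n x : (m <= n)%N -> pnZp p_pr n x -> pnZp p_pr m x.
Proof.
move=> mn [a _ <-]; exists (p%:R ^+ (n - m) * a) => //.
by rewrite rmorphM rmorphXn rmorph_nat mulrA -exprD subnKC.
Qed.

Definition padic_open U := forall x, U x ->
  exists n, forall y, pnZp p_pr n y -> U (x + y).

Lemma padic_openT : padic_open setT.
Proof. by exists 0%N. Qed.

Lemma padic_openI : setI_closed padic_open.
Proof.
move=> U V oU oV x [/oU[m Um] /oV[n Vn]]; exists (maxn m n) => y y_mn.
by split; [apply: Um | apply: Vn]; apply: pnZp_le y_mn;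
  rewrite (leq_maxl, leq_maxr).
Qed.

Lemma padic_open_bigU (I : Type) (f : I -> set Qp) :
  (forall i, padic_open (f i)) -> padic_open (\bigcup_i f i).
Proof.
move=> of_ x [i _ /of_[n fn]]; exists n => y /fn fy.
by exists i.
Qed.

HB.instance Definition _ := isOpenTopological.Build Qp
  padic_openT padic_openI padic_open_bigU.

Lemma pnZp_open n : open (pnZp p_pr n).
Proof. by move=> x xn; exists n => y; apply: pnZpD. Qed.

Lemma padic_nbhsP x U :
  nbhs x U <-> exists n, forall y, pnZp p_pr n y -> U (x + y).
Proof.
split=> [[V [oV Vx VU]]|[n nU]].
  by have [n nV] := oV x Vx; exists n => y /nV /VU.
exists [set z | pnZp p_pr n (z - x)]; split=> /=.
- move=> z zn; exists n => y yn /=.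
  by rewrite addrAC; apply: pnZpD.
- by rewrite subrr; apply: pnZp0.
- by move=> z /nU; rewrite addrC subrK.
Qed.

End PadicTopology.

Section Analytic.
Variables (p : nat) (p_pr : prime p).
Local Notation Qp := (padic p_pr).

Definition monomial n (e : {ffun 'I_n -> nat}) (h : 'rV[Qp]_n) : Qp :=
  \prod_(i < n) h 0 i ^+ e i.

(* f is the sum of a power series in a neighbourhood of a; the series is
   required to converge unconditionally, i.e. along the directed set of all
   finite sets of exponents. *)
Definition analytic_at n m (f : 'rV[Qp]_n -> 'rV[Qp]_m) (a : 'rV[Qp]_n) :=
  exists c : {ffun 'I_n -> nat} -> 'rV[Qp]_m,
    \forall h \near (0 : 'rV[Qp]_n),
      partial_sum (fun e => monomial e h *: c e) @ totally --> f (a + h).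

End Analytic.

(* A chart of T with values in Q_p^d; only the restriction of chart_map to
   chart_dom and that of chart_inv to the image of chart_dom are relevant. *)
Record chart p (p_pr : prime p) (d : nat) (T : Type) := Chart {
  chart_dom : set T;
  chart_map : T -> 'rV[padic p_pr]_d;
  chart_inv : 'rV[padic p_pr]_d -> T }.

Record manifold p (p_pr : prime p) (d : nat) (T : Type) := Manifold {
  atlas : set (chart p_pr d T);
  chart_cover : forall x, exists2 phi, atlas phi & chart_dom phi x;
  chart_mapK : forall phi, atlas phi -> forall x, chart_dom phi x ->
    chart_inv phi (chart_map phi x) = x;
  chart_overlap : forall phi psi, atlas phi -> atlas psi ->
    open (chart_map phi @` (chart_dom phi `&` chart_dom psi));
  chart_transition : forall phi psi, atlas phi -> atlas psi ->
    forall x, chart_dom phi x -> chart_dom psi x ->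
    analytic_at (chart_map psi \o chart_inv phi) (chart_map phi x) }.

(* T with the topology defined by the atlas. *)
Definition mspace p (p_pr : prime p) d (T : Type) (M : manifold p_pr d T) :
  Type := T.
HB.instance Definition _ p (p_pr : prime p) d (T : choiceType)
  (M : manifold p_pr d T) := Choice.copy (mspace M) T.

Section ManifoldTopology.
Variables (p : nat) (p_pr : prime p) (d : nat) (T : choiceType).
Variable M : manifold p_pr d T.

Definition atlas_open (U : set T) :=
  forall phi, atlas M phi -> open (chart_map phi @` (U `&` chart_dom phi)).

Lemma atlas_openT : atlas_open setT.
Proof.
move=> phi Mphi; rewrite setTI -(setIid (chart_dom phi)).
exact: (chart_overlap Mphi Mphi).
Qed.

Lemma atlas_openI : setI_closed atlas_open.
Proof.
move=> U V oU oV phi Mphi; have phiK := chart_mapK Mphi.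
rewrite (_ : _ @` _ = (chart_map phi @` (U `&` chart_dom phi)) `&`
  (chart_map phi @` (V `&` chart_dom phi))); first by apply: openI; auto.
apply/seteqP; split=> [_ [x [[Ux Vx] dx] <-]|y].
  by split; exists x.
move=> [[x [Ux dx] <-]] [x' [Vx' dx'] /(congr1 (chart_inv phi))].
rewrite !phiK // => x'x; exists x => //.
by do !split=> //; rewrite -x'x.
Qed.

Lemma atlas_open_bigU (I : Type) (f : I -> set T) :
  (forall i, atlas_open (f i)) -> atlas_open (\bigcup_i f i).
Proof.
move=> of_ phi Mphi; rewrite setI_bigcupl image_bigcup.
by apply: bigcup_open => i _; apply: of_.
Qed.

HB.instance Definition _ := isOpenTopological.Build (mspace M)
  atlas_openT atlas_openI atlas_open_bigU.

End ManifoldTopology.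

Section AnalyticMaps.
Variables (p : nat) (p_pr : prime p).

Definition analytic_map_at d d' (T T' : choiceType) (M : manifold p_pr d T)
    (M' : manifold p_pr d' T') (f : T -> T') (x : T) :=
  {for x, continuous (f : mspace M -> mspace M')} /\
  forall phi psi, atlas M phi -> atlas M' psi ->
    chart_dom phi x -> chart_dom psi (f x) ->
    analytic_at (chart_map psi \o f \o chart_inv phi) (chart_map phi x).

(* Analyticity of a map of two variables at (x, y), expressed in the charts
   of the product manifold. *)
Definition analytic_map2_at d1 d2 d (T1 T2 T : choiceType)
    (M1 : manifold p_pr d1 T1) (M2 : manifold p_pr d2 T2)
    (M : manifold p_pr d T) (f : T1 -> T2 -> T) (x : T1) (y : T2) :=
  {for (x, y), continuous
    (fun z : mspace M1 * mspace M2 => f z.1 z.2 : mspace M)} /\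
  forall phi1 phi2 psi, atlas M1 phi1 -> atlas M2 phi2 -> atlas M psi ->
    chart_dom phi1 x -> chart_dom phi2 y -> chart_dom psi (f x y) ->
    analytic_at (fun w : 'rV_(d1 + d2) => chart_map psi
        (f (chart_inv phi1 (lsubmx w)) (chart_inv phi2 (rsubmx w))))
      (row_mx (chart_map phi1 x) (chart_map phi2 y)).

(* f restricts to an analytic diffeomorphism from the open set U onto an open
   set. *)
Definition open_embedding d d' (T T' : choiceType) (M : manifold p_pr d T)
    (M' : manifold p_pr d' T') (U : set T) (f : T -> T') :=
  [/\ open (U : set (mspace M)), open (f @` U : set (mspace M')),
      forall x, U x -> analytic_map_at M M' f x &
      exists g : T' -> T, forall x, U x ->
        g (f x) = x /\ analytic_map_at M' M g (f x)].

Record lie_structure d (T : groupType) := LieStructure {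
  lie_manifold :> manifold p_pr d T;
  lie_hausdorff : hausdorff_space (mspace lie_manifold);
  lie_mul_analytic : forall x y : T,
    analytic_map2_at lie_manifold lie_manifold lie_manifold
      (fun u v => u * v)%g x y;
  lie_inv_analytic : forall x : T,
    analytic_map_at lie_manifold lie_manifold (fun u => u^-1)%g x }.

End AnalyticMaps.

Section PadicManifold.
Variables (p : nat) (p_pr : prime p).
Local Notation Qp := (padic p_pr).

Lemma partial_sum_single (I : choiceType) (V : zmodType) (g : I -> V) (i : I)
    (A : {fset I}) :
  (i \in A)%fset -> (forall j, j != i -> g j = 0) -> partial_sum g A = g i.
Proof.
move=> iA g0; rewrite /partial_sum (bigD1 [` iA]%fset) //= big1 ?addr0 //.
by move=> j ji; apply: g0; apply: contraNneq ji => ji; apply/eqP/val_inj.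
Qed.

Lemma analytic_at_id n (a : 'rV[Qp]_n) : analytic_at id a.
Proof.
pose e1 i : {ffun 'I_n -> nat} := [ffun j => (j == i : nat)].
exists (fun e => (e == [ffun=> 0%N])%:R *: a +
  \sum_i (e == e1 i)%:R *: delta_mx 0 i).
apply: filterE => h U hU.
pose A0 : {fset {ffun 'I_n -> nat}} := ([ffun=> 0%N] |` [fset e1 i | i in 'I_n])%fset.
exists A0 => // A /= A0A.
suff -> : partial_sum (fun e => monomial e h *: ((e == [ffun=> 0%N])%:R *: a +
    \sum_i (e == e1 i)%:R *: delta_mx 0 i)) A = a + h.
  exact: nbhs_singleton hU.
rewrite /partial_sum; under eq_bigr do rewrite scalerDr scaler_sumr.
rewrite big_split exchange_big /=; congr (_ + _).
  rewrite -[LHS]/(partial_sum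
    (fun e => monomial e h *: ((e == [ffun=> 0%N])%:R *: a)) A).
  rewrite (@partial_sum_single _ _ _ [ffun=> 0%N]).
  - rewrite eqxx scale1r /monomial big1 ?scale1r // => i _.
    by rewrite ffunE expr0.
  - by apply: (fsubsetP A0A); rewrite !inE eqxx.
  - by move=> e /negPf ->; rewrite scale0r scaler0.
rewrite [RHS]row_sum_delta; apply: eq_bigr => i _.
rewrite -[LHS]/(partial_sum
  (fun e => monomial e h *: ((e == e1 i)%:R *: delta_mx 0 i)) A).
rewrite (@partial_sum_single _ _ _ (e1 i)).
- rewrite eqxx scale1r /monomial (bigD1 i) //= big1 => [|j /negPf ji].
    by rewrite ffunE eqxx expr1 mulr1.
  by rewrite ffunE ji expr0.
- apply: (fsubsetP A0A); rewrite !inE; apply/orP; right.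
  by apply/imfsetP; exists i.
- by move=> e /negPf ->; rewrite scale0r scaler0.
Qed.

Definition padic_chart : chart p_pr 1 Qp :=
  Chart setT (fun x => const_mx x) (fun v : 'rV_1 => v 0 0).

Lemma padic_chartK x : chart_inv padic_chart (chart_map padic_chart x) = x.
Proof. by rewrite /= mxE. Qed.

Lemma padic_chart_invK v : chart_map padic_chart (chart_inv padic_chart v) = v.
Proof. by apply/rowP => i; rewrite !mxE ord1. Qed.

Program Definition padic_manifold : manifold p_pr 1 Qp :=
  @Manifold p p_pr 1 Qp [set padic_chart] _ _ _ _.
Next Obligation. by move=> x; exists padic_chart. Qed.
Next Obligation. by move=> _ -> x _; apply: padic_chartK. Qed.
Next Obligation.
move=> _ _ -> ->; rewrite (_ : _ @` _ = setT); first exact: openT.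
by apply/seteqP; split=> // v _; exists (v 0 0) => //; apply: padic_chart_invK.
Qed.
Next Obligation.
move=> _ _ -> -> x _ _; rewrite (_ : _ \o _ = id); first exact: analytic_at_id.
by apply/funext => v; apply: padic_chart_invK.
Qed.

End PadicManifold.

Record normal_subgroup (T : groupType) := NormalSubgroup {
  nsub_set :> set T;
  nsub1 : nsub_set 1%g;
  nsubM : forall x y, nsub_set x -> nsub_set y -> nsub_set (x * y)%g;
  nsubV : forall x, nsub_set x -> nsub_set x^-1%g;
  nsubJ : forall x y, nsub_set x -> nsub_set (x ^ y)%g }.

Section QuotientGroup.
Variables (T : groupType) (K : normal_subgroup T).
Local Open Scope group_scope.
Local Open Scope quotient_scope.
Implicit Types x y z : T.

Definition same_coset : rel T := fun x y => `[< nsub_set K (x^-1 * y) >].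

Lemma same_coset_refl : reflexive same_coset.
Proof. by move=> x; apply/asboolP; rewrite mulVg; apply: nsub1. Qed.

Lemma same_coset_sym : symmetric same_coset.
Proof.
suff sym x y : same_coset x y -> same_coset y x.
  by move=> x y; apply/idP/idP; apply: sym.
by move=> /asboolP/nsubV; rewrite invgM invgK => Kyx; apply/asboolP.
Qed.

Lemma same_coset_trans : transitive same_coset.
Proof.
move=> y x z /asboolP Kxy /asboolP /(nsubM Kxy).
by rewrite mulgA mulgK => Kxz; apply/asboolP.
Qed.

Canonical same_coset_equiv :=
  EquivRel same_coset same_coset_refl same_coset_sym same_coset_trans.

Definition quotient_group := {eq_quot same_coset}%qT.
HB.instance Definition _ := Choice.on quotient_group.
HB.instance Definition _ := EqQuotient.on quotient_group.

Definition qone : quotient_group := \pi_quotient_group 1.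
Definition qinv (x : quotient_group) : quotient_group :=
  \pi_quotient_group (repr x)^-1.
Definition qmul (x y : quotient_group) : quotient_group :=
  \pi_quotient_group (repr x * repr y).

Lemma same_cosetP x y : reflect (nsub_set K (x^-1 * y))
  (\pi_quotient_group x == \pi_quotient_group y).
Proof. by rewrite eqmodE; apply: asboolP. Qed.

Lemma repr_coset x : nsub_set K (x^-1 * repr (\pi_quotient_group x)).
Proof. by apply/same_cosetP; rewrite reprK. Qed.

Lemma qmulE x y :
  qmul (\pi_quotient_group x) (\pi_quotient_group y) = \pi_quotient_group (x * y).
Proof.
apply/esym/eqP/same_cosetP.
move: (nsubM (nsubJ y (repr_coset x)) (repr_coset y)).
by rewrite invgM /conjg !mulgA mulgK.
Qed.

Lemma qinvE x : qinv (\pi_quotient_group x) = \pi_quotient_group x^-1.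
Proof.
apply/eqP/same_cosetP; rewrite invgK.
have := nsubJ x^-1 (repr_coset x).
by rewrite /conjg invgK !mulgA mulgV mul1g.
Qed.

Lemma qmulA : associative qmul.
Proof.
elim/quotW=> x; elim/quotW=> y; elim/quotW=> z.
by rewrite (qmulE y z) (qmulE x y) (qmulE x) (qmulE _ z) mulgA.
Qed.

Lemma qmul1 : left_id qone qmul.
Proof. by elim/quotW=> x; rewrite qmulE mul1g. Qed.

Lemma qmulr1 : right_id qone qmul.
Proof. by elim/quotW=> x; rewrite qmulE mulg1. Qed.

Lemma qmulV : left_inverse qone qinv qmul.
Proof. by elim/quotW=> x; rewrite qinvE qmulE mulVg. Qed.

Lemma qmulrV : right_inverse qone qinv qmul.
Proof. by elim/quotW=> x; rewrite qinvE qmulE mulgV. Qed.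

HB.instance Definition _ := isGroup.Build quotient_group
  qmulA qmul1 qmulr1 qmulV qmulrV.

End QuotientGroup.

Section GeneralLinear.
Variables (F : fieldType) (d : nat).

Definition GL := {A : 'M[F]_d | A \in unitmx}.
HB.instance Definition _ := Choice.on GL.
Implicit Types A B : GL.

Definition GLone : GL := exist _ 1%:M (unitmx1 F d).
Definition GLmul A B : GL := exist _ (val A *m val B)
  (etrans (unitmx_mul (val A) (val B)) (introT andP (conj (valP A) (valP B)))).
Definition GLinv A : GL := exist _ (invmx (val A))
  (etrans (unitmx_inv (val A)) (valP A)).

Lemma GLmulA : associative GLmul.
Proof. by move=> A B C; apply: val_inj; apply: mulmxA. Qed.

Lemma GLmul1 : left_id GLone GLmul.
Proof. by move=> A; apply: val_inj; apply: mul1mx. Qed.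

Lemma GLmulr1 : right_id GLone GLmul.
Proof. by move=> A; apply: val_inj; apply: mulmx1. Qed.

Lemma GLmulV : left_inverse GLone GLinv GLmul.
Proof. by move=> A; apply: val_inj; apply: mulVmx (valP A). Qed.

Lemma GLmulrV : right_inverse GLone GLinv GLmul.
Proof. by move=> A; apply: val_inj; apply: mulmxV (valP A). Qed.

HB.instance Definition _ := isGroup.Build GL
  GLmulA GLmul1 GLmulr1 GLmulV GLmulrV.

End GeneralLinear.

Definition isomorphic_to_subgroup (T T' : groupType) :=
  exists S : set T', [/\ S 1%g, forall x y, S x -> S y -> S (x * y^-1)%g &
    exists f : T -> T', {morph f : x y / (x * y)%g} /\ set_bij setT S f].

Section Structure.
Variables (p : nat) (p_pr : prime p).

(* Z and K are closed, Z is abelian, K/Z is discrete for the quotient topology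
   (every subset of K/Z, that is every subset of K stable under translation by
   Z, is open in K), and G/K is isomorphic, as a group, to a subgroup of
   GL_d(Q_p). *)
Definition abelian_discrete_linear d (T : groupType)
    (L : lie_structure p_pr d T) :=
  exists Z K : normal_subgroup T, [/\ Z `<=` K,
    closed (Z : set (mspace L)) /\ closed (K : set (mspace L)),
    forall x y, nsub_set Z x -> nsub_set Z y -> (x * y = y * x)%g,
    forall A : set T, A `<=` K -> (forall a z, A a -> nsub_set Z z -> A (a * z)%g) ->
      exists2 U : set (mspace L), open U & A = U `&` K &
    isomorphic_to_subgroup (quotient_group K) (GL (padic p_pr) d)].

End Structure.

Section GroupColimit.
Variables (I : choiceType) (A : I -> groupType).
Variable glue : forall i j, A i -> A j -> Prop.
Local Open Scope group_scope.
Local Open Scope quotient_scope.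

Definition word := seq {i : I & A i}.
Definition letter i (x : A i) : {i : I & A i} := Tagged A x.

(* The congruence on words in the elements of the groups A i generated by
   the multiplication laws of the A i and by the relations x = y for
   glue x y. *)
Inductive word_eq : word -> word -> Prop :=
| word_eq_refl u : word_eq u u
| word_eq_sym u v : word_eq u v -> word_eq v u
| word_eq_trans v u w : word_eq u v -> word_eq v w -> word_eq u w
| word_eq_cat u u' v v' :
    word_eq u u' -> word_eq v v' -> word_eq (u ++ v) (u' ++ v')
| word_eq_one i : word_eq [:: letter (1 : A i)] [::]
| word_eq_mul i (x y : A i) :
    word_eq [:: letter x; letter y] [:: letter (x * y)]
| word_eq_glue i j (x : A i) (y : A j) :
    glue x y -> word_eq [:: letter x] [:: letter y].

Definition word_eqb : rel word := fun u v => `[< word_eq u v >].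

Lemma word_eqb_refl : reflexive word_eqb.
Proof. by move=> u; apply/asboolP; apply: word_eq_refl. Qed.

Lemma word_eqb_sym : symmetric word_eqb.
Proof. by move=> u v; apply/asboolP/asboolP; apply: word_eq_sym. Qed.

Lemma word_eqb_trans : transitive word_eqb.
Proof.
by move=> v u w /asboolP uv /asboolP vw; apply/asboolP; apply: word_eq_trans vw.
Qed.

Canonical word_equiv :=
  EquivRel word_eqb word_eqb_refl word_eqb_sym word_eqb_trans.

(* The quotient of the free product of the A i by the relations x = y for
   glue x y. *)
Definition colimit := {eq_quot word_eqb}%qT.
HB.instance Definition _ := Choice.on colimit.
HB.instance Definition _ := EqQuotient.on colimit.

Definition winv (u : word) : word :=
  rev [seq letter (tagged x : A (tag x))^-1 | x <- u].

Definition cone : colimit := \pi_colimit [::].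
Definition cmul (x y : colimit) : colimit := \pi_colimit (repr x ++ repr y).
Definition cinv (x : colimit) : colimit := \pi_colimit (winv (repr x)).

Lemma word_eqP u v : \pi_colimit u = \pi_colimit v <-> word_eq u v.
Proof.
split=> [/eqP|uv]; first by rewrite eqmodE => /asboolP.
by apply/eqP; rewrite eqmodE; apply/asboolP.
Qed.

Lemma word_eq_repr u : word_eq (repr (\pi_colimit u)) u.
Proof. by apply/word_eqP; rewrite reprK. Qed.

Lemma cmulE u v : cmul (\pi_colimit u) (\pi_colimit v) = \pi_colimit (u ++ v).
Proof. by apply/word_eqP; apply: word_eq_cat; apply: word_eq_repr. Qed.

Lemma winv_cat u v : winv (u ++ v) = winv v ++ winv u.
Proof. by rewrite /winv map_cat rev_cat. Qed.

Lemma winvl u : word_eq (winv u ++ u) [::].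
Proof.
elim: u => [|[i x] u IHu]; first exact: word_eq_refl.
rewrite -cat1s winv_cat -catA; apply: word_eq_trans IHu.
apply: word_eq_cat (word_eq_refl _) _; rewrite catA.
rewrite -[X in word_eq _ X]cat0s; apply: word_eq_cat (word_eq_refl _).
apply: word_eq_trans (word_eq_one i).
by rewrite -(mulVg x); apply: word_eq_mul.
Qed.

Lemma winvK : involutive winv.
Proof.
move=> u; rewrite /winv map_rev revK -map_comp map_id_in // => -[i x] _ /=.
by rewrite invgK.
Qed.

Lemma winvr u : word_eq (u ++ winv u) [::].
Proof. by rewrite -{1}(winvK u); apply: winvl. Qed.

Lemma cmulA : associative cmul.
Proof.
elim/quotW=> u; elim/quotW=> v; elim/quotW=> w.
by rewrite (cmulE v w) (cmulE u v) (cmulE u) (cmulE _ w) catA.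
Qed.

Lemma cmul1 : left_id cone cmul.
Proof. by elim/quotW=> u; rewrite cmulE. Qed.

Lemma cmulr1 : right_id cone cmul.
Proof. by elim/quotW=> u; rewrite cmulE cats0. Qed.

Lemma cmulV : left_inverse cone cinv cmul.
Proof.
move=> x; rewrite /cinv -{2}[x]reprK cmulE.
by apply/word_eqP; apply: winvl.
Qed.

Lemma cmulrV : right_inverse cone cinv cmul.
Proof.
move=> x; rewrite /cinv -{1}[x]reprK cmulE.
by apply/word_eqP; apply: winvr.
Qed.

HB.instance Definition _ := isGroup.Build colimit
  cmulA cmul1 cmulr1 cmulV cmulrV.

Definition colimit_in i (x : A i) : colimit := \pi_colimit [:: letter x].

Lemma colimit_inM i : {morph @colimit_in i : x y / x * y}.
Proof.
move=> x y; apply/esym; apply: (etrans (cmulE _ _)); apply/word_eqP.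
exact: word_eq_mul.
Qed.

Lemma colimit_in_glue i j (x : A i) (y : A j) :
  glue x y -> colimit_in x = colimit_in y.
Proof. by move=> xy; apply/word_eqP/word_eq_glue. Qed.

End GroupColimit.

Section Amalgam.
Variables (A1 A2 : groupType) (B : set A2) (f : A2 -> A1).

Definition amalgam_factor (b : bool) : groupType := if b then A2 else A1.

Inductive amalgam_glue : forall i j : bool,
    amalgam_factor i -> amalgam_factor j -> Prop :=
  AmalgamGlue (b : A2) : B b -> @amalgam_glue false true (f b) b.

(* The pushout A1 *_B A2, where B is a subgroup of A2 identified with a
   subgroup of A1 by the restriction of f to B. *)
Definition amalgam : groupType := colimit amalgam_glue.
Definition amalgam_inl (x : A1) : amalgam :=
  @colimit_in _ _ amalgam_glue false x.
Definition amalgam_inr (x : A2) : amalgam :=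
  @colimit_in _ _ amalgam_glue true x.

End Amalgam.

Section Tower.
Variables (p : nat) (p_pr : prime p).

Definition padic_group : groupType := Algebra.to_multiplicative (padic p_pr).

(* The group G_n together with the inclusion of the last copy of Q_p. *)
Fixpoint tower_data (n : nat) : {G : groupType & padic_group -> G} :=
  if n isn't m.+1 then existT _ padic_group id else
  let f := projT2 (tower_data m) in
  existT _ (amalgam (pnZp p_pr m : set padic_group) f)
    (amalgam_inr (pnZp p_pr m : set padic_group) f).

Definition tower n : groupType := projT1 (tower_data n).
Definition last_copy n : padic_group -> tower n := projT2 (tower_data n).
Definition tower_inc n : tower n -> tower n.+1 := @amalgam_inl _ _ _ _.

Inductive tower_glue : forall m n, tower m -> tower n -> Prop :=
  TowerGlue n (x : tower n) : tower_glue x (tower_inc x).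

Definition tower_limit : groupType := colimit tower_glue.
Definition tower_in n (x : tower n) : tower_limit :=
  @colimit_in _ _ tower_glue n x.

Definition standard_lie_structures
    (L : forall n, lie_structure p_pr 1 (tower n))
    (Lim : lie_structure p_pr 1 tower_limit) :=
  [/\ open_embedding (padic_manifold p_pr) (L 0%N) setT (@last_copy 0),
      forall n, open_embedding (padic_manifold p_pr) (L n.+1)
        (pnZp p_pr n) (@last_copy n.+1) &
      forall n, open_embedding (L n) Lim setT (@tower_in n)].

End Tower.

(* Main.v *)
Require Import Defs.
From HB Require Import structures.
From mathcomp Require Import all_boot all_order all_algebra finmap cyclic.
From mathcomp Require Import all_classical topology.
From mathcomp Require Import summability.

(* Existence: the first copy of Q_p embeds in every G_n and in G, and every
   element commutes with a small enough ball p^n Z_p of it.  Hence the cosets of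
   Z_p, with their coordinates in Z_p, form an atlas in which multiplication and
   inversion are locally affine.  The embeddings come from an action of an
   amalgamated product A1 *_B A2 on a set on which A1 acts freely.

   Obstruction: let Z and K be as in the assertion.  A homomorphism from Q_p to
   the multiplicative group of Q_p is trivial, since its values are divisible;
   hence K contains all copies of Q_p, so K = G and Z is open.  Thus Z contains
   z = p^k in the first copy for some k.  Let t = 1/p in the last copy of Q_p in
   G_(k+2).  An action of G on Q_p x int shows that z and its conjugate by t do
   not commute, although both lie in the abelian group Z. *)

Set Implicit Arguments.
Unset Strict Implicit.
Unset Printing Implicit Defensive.

Import GRing.Theory.
Local Open Scope classical_set_scope.
Local Open Scope ring_scope.

(** * Manifolds with translations as transition maps *)

Section Analytic.
Variables (p : nat) (p_pr : prime p).
Local Notation Qp := (padic p_pr).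

Lemma pnZpM n a x : pnZp p_pr 0 a -> pnZp p_pr n x -> pnZp p_pr n (a * x).
Proof.
move=> [y _ <-] [z _ <-]; exists (y * z) => //.
by rewrite expr0 mul1r rmorphM mulrCA.
Qed.

(** There are finitely many coordinates, so the radii found entrywise have a common bound. *)
Lemma nbhs_rowP n (v : 'rV[Qp]_n) (U : set 'rV[Qp]_n) :
  nbhs v U <-> exists k, forall h : 'rV[Qp]_n,
    (forall i, pnZp p_pr k (h 0 i)) -> U (v + h).
Proof.
split=> [[P vP PU]|[k kU]].
  have /choice[k kP] : forall i, exists k, forall y,
      pnZp p_pr k y -> P 0 i (v 0 i + y).
    by move=> i; apply/padic_nbhsP/vP.
  exists (\max_i k i)%N => h hk; apply: PU => i j; rewrite ord1 mxE.
  by apply: kP; apply: pnZp_le (hk j); apply: leq_bigmax.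
exists (fun i j => [set x | pnZp p_pr k (x - v i j)]) => [i j|w wP].
  by apply/padic_nbhsP; exists k => y; rewrite /= addrAC subrr add0r.
rewrite -(subrK v w) addrC; apply: kU => i.
by rewrite !mxE; apply: wP.
Qed.

Lemma open_row n (U : set 'rV[Qp]_n) :
  open U <-> forall v, U v ->
    exists k, forall h : 'rV[Qp]_n,
      (forall i, pnZp p_pr k (h 0 i)) -> U (v + h).
Proof.
by rewrite openE; split=> oU v Uv; have := oU v Uv => /nbhs_rowP.
Qed.

(** The power series has constant term [f a], the rows of [M] as linear coefficients and no other
    terms; its partial sums are constant once the finite set contains the exponents of degree at
    most one. *)
Lemma analytic_at_affine n m (f : 'rV[Qp]_n -> 'rV[Qp]_m) a (M : 'M_(n, m)) k :
  (forall h : 'rV[Qp]_n, (forall i, pnZp p_pr k (h 0 i)) ->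
    f (a + h) = f a + h *m M) ->
  analytic_at f a.
Proof.
move=> fM; pose e1 i : {ffun 'I_n -> nat} := [ffun j => (j == i : nat)].
pose c (e : {ffun 'I_n -> nat}) := (e == [ffun=> 0%N])%:R *: f a +
  \sum_i (e == e1 i)%:R *: row i M.
exists c; apply/nbhs_rowP; exists k => h hk; rewrite add0r fM // => U hU.
pose A0 : {fset {ffun 'I_n -> nat}} :=
  ([ffun=> 0%N] |` [fset e1 i | i in 'I_n])%fset.
exists A0 => // A /= A0A.
suff -> : partial_sum (fun e => monomial e h *: c e) A = f a + h *m M.
  exact: nbhs_singleton hU.
rewrite /partial_sum /c; under eq_bigr do rewrite scalerDr scaler_sumr.
rewrite big_split exchange_big /=; congr (_ + _).
  rewrite -[LHS]/(partial_sum
    (fun e => monomial e h *: ((e == [ffun=> 0%N])%:R *: f a)) A).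
  rewrite (@partial_sum_single _ _ _ [ffun=> 0%N]).
  - rewrite eqxx /monomial big1 ?scale1r // => i _.
    by rewrite ffunE expr0.
  - by apply: (fsubsetP A0A); rewrite !inE eqxx.
  - by move=> e /negPf ->; rewrite scale0r scaler0.
rewrite mulmx_sum_row; apply: eq_bigr => i _.
rewrite -[LHS]/(partial_sum
  (fun e => monomial e h *: ((e == e1 i)%:R *: row i M)) A).
rewrite (@partial_sum_single _ _ _ (e1 i)).
- rewrite eqxx scale1r /monomial (bigD1 i) //= big1 => [|j /negPf ji].
    by rewrite ffunE eqxx expr1 mulr1.
  by rewrite ffunE ji expr0.
- apply: (fsubsetP A0A); rewrite !inE; apply/orP; right.
  by apply/imfsetP; exists i.
- by move=> e /negPf ->; rewrite scale0r scaler0.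
Qed.

(* [s] is an action of Q_p on T whose orbit maps are, locally and up to
   translation, inverse to the charts. *)
Record translation_charts (T : choiceType) (M : manifold p_pr 1 T)
    (s : T -> Qp -> T) : Prop := TranslationCharts {
  shift0 : forall x, s x 0 = x;
  shiftD : forall x a b, s (s x a) b = s x (a + b);
  shift_chart : forall phi, atlas M phi -> forall x, chart_dom phi x ->
    exists n, forall a, pnZp p_pr n a -> chart_dom phi (s x a) /\
      chart_map phi (s x a) = chart_map phi x + const_mx a }.

Section OneManifold.
Variables (T : choiceType) (M : manifold p_pr 1 T) (s : T -> Qp -> T).
Hypothesis sM : translation_charts M s.

(** [chart_inv] is controlled only on the image of the domain; the orbit of [x] shows that this
    image contains a ball around [chart_map phi x]. *)
Lemma chart_inv_shift phi x : atlas M phi -> chart_dom phi x ->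
  exists n, forall v : 'rV_1, pnZp p_pr n (v 0 0) ->
    chart_inv phi (chart_map phi x + v) = s x (v 0 0).
Proof.
move=> Mphi dx; have [n nP] := shift_chart sM Mphi dx; exists n => v vn.
have [dsx sx] := nP _ vn; rewrite -[RHS](chart_mapK Mphi) // sx.
by congr (chart_inv _ (_ + _)); apply/rowP => i; rewrite ord1 mxE.
Qed.

Lemma open_shift x n :
  open ([set s x a | a in pnZp p_pr n] : set (mspace M)).
Proof.
move=> phi Mphi; apply/open_row => _ [y [[a an <-] dy] <-].
have [m mP] := shift_chart sM Mphi dy.
exists (maxn m n) => h /(_ 0) h0.
have [|d1 d2] := mP (h 0 0); first by apply: pnZp_le h0; apply: leq_maxl.
exists (s (s x a) (h 0 0)).
  split=> //; exists (a + h 0 0); last by rewrite (shiftD sM).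
  by apply: pnZpD => //; apply: pnZp_le h0; apply: leq_maxr.
by rewrite d2; congr (_ + _); apply/rowP => i; rewrite ord1 mxE.
Qed.

(** The orbit balls form a neighbourhood basis, so topological questions can be settled with [s]
    instead of charts. *)
Lemma nbhs_shiftP x (U : set (mspace M)) : nbhs (x : mspace M) U <->
  exists n, forall a, pnZp p_pr n a -> U (s x a).
Proof.
split=> [[V [oV Vx VU]]|[n nU]].
  have [phi Mphi dx] := chart_cover M x.
  have /open_row/(_ (chart_map phi x)) := oV phi Mphi.
  case; first by exists x.
  move=> k kV; have [m mV] := chart_inv_shift Mphi dx.
  exists (maxn m k) => a an; apply: VU.
  have [|y [Vy dy]] := kV (const_mx a).
    by move=> i; rewrite mxE; apply: pnZp_le an; apply: leq_maxr.
  move=> /(congr1 (chart_inv phi)); rewrite mV mxE.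
    by rewrite (chart_mapK Mphi) // => <-.
  by apply: pnZp_le an; apply: leq_maxl.
exists [set s x a | a in pnZp p_pr n]; split.
- exact: open_shift.
- by exists 0; [apply: pnZp0 | apply: shift0 sM _].
- by move=> _ [a an <-]; apply: nU.
Qed.

End OneManifold.

(** In charts such a map is locally affine with linear part [c]. Taking [c] in Z_p keeps the balls
    p^n Z_p stable; the values used are 1 for embeddings and -1 for inversion. *)
Lemma analytic_map_shift (T T' : choiceType) (M : manifold p_pr 1 T)
    (M' : manifold p_pr 1 T') s s' (f : T -> T') x c k :
  translation_charts M s -> translation_charts M' s' -> pnZp p_pr 0 c ->
  (forall a, pnZp p_pr k a -> f (s x a) = s' (f x) (c * a)) ->
  analytic_map_at M M' f x.
Proof.
move=> sM sM' c0 fs; split=> [U|phi psi Mphi Mpsi dx dfx].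
  move=> /(nbhs_shiftP sM')[n nU]; apply/(nbhs_shiftP sM).
  exists (maxn k n) => a ak /=; rewrite fs.
    by apply: nU; apply: pnZpM => //; apply: pnZp_le ak; apply: leq_maxr.
  by apply: pnZp_le ak; apply: leq_maxl.
have [m mP] := chart_inv_shift sM Mphi dx.
have [n nP] := shift_chart sM' Mpsi dfx.
apply: (@analytic_at_affine _ _ _ _ c%:M (maxn k (maxn m n))) => h /(_ 0) h0 /=.
rewrite mP ?(chart_mapK Mphi) ?fs.
- have [|_ ->] := nP (c * h 0 0).
    by apply: pnZpM => //; apply: pnZp_le h0; rewrite !leq_max leqnn !orbT.
  by congr (_ + _); apply/rowP => i; rewrite ord1 mul_mx_scalar !mxE.
- by apply: pnZp_le h0; rewrite leq_max leqnn.
- by [].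
- by apply: pnZp_le h0; rewrite !leq_max leqnn !orbT.
Qed.

Lemma analytic_map2_shift (T : choiceType) (M : manifold p_pr 1 T) s
    (f : T -> T -> T) x y k :
  translation_charts M s ->
  (forall a b, pnZp p_pr k a -> pnZp p_pr k b ->
    f (s x a) (s y b) = s (f x y) (a + b)) ->
  analytic_map2_at M M M f x y.
Proof.
move=> sM fs; split=> [U|phi1 phi2 psi M1 M2 Mpsi dx dy df].
  move=> /(nbhs_shiftP sM)[n nU].
  pose W z : set (mspace M) := [set s z a | a in pnZp p_pr (maxn k n)].
  exists (W x, W y).
    by split; apply/(nbhs_shiftP sM); exists (maxn k n) => a an; exists a.
  move=> [u v] /= [[a an <-] [b bn <-]]; rewrite fs.
  - by apply: nU; apply: pnZpD; [move: an | move: bn]; apply: pnZp_le;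
      apply: leq_maxr.
  - by apply: pnZp_le an; apply: leq_maxl.
  - by apply: pnZp_le bn; apply: leq_maxl.
have [m1 m1P] := chart_inv_shift sM M1 dx.
have [m2 m2P] := chart_inv_shift sM M2 dy.
have [n nP] := shift_chart sM Mpsi df.
pose N := maxn k (maxn n (maxn m1 m2)).
have [kN nN m1N m2N] : [/\ k <= N, n <= N, m1 <= N & m2 <= N]%N.
  by rewrite /N !leq_max !leqnn !orbT.
(* The displacements of the two arguments add up, so the linear part is (v, w) |-> v + w. *)
apply: (@analytic_at_affine _ _ _ _ (col_mx 1%:M 1%:M) N) => h hN.
have hl m : (m <= N)%N -> pnZp p_pr m (lsubmx h 0 0).
  by move=> mN; rewrite mxE; apply: pnZp_le (hN _).
have hr m : (m <= N)%N -> pnZp p_pr m (rsubmx h 0 0).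
  by move=> mN; rewrite mxE; apply: pnZp_le (hN _).
have -> : h *m col_mx 1%:M 1%:M = lsubmx h + rsubmx h.
  by rewrite -{1}(hsubmxK h) mul_row_col !mulmx1.
have -> : row_mx (chart_map phi1 x) (chart_map phi2 y) + h =
    row_mx (chart_map phi1 x + lsubmx h) (chart_map phi2 y + rsubmx h).
  by rewrite -{1}(hsubmxK h) add_row_mx.
rewrite !row_mxKl !row_mxKr m1P ?m2P ?fs ?(chart_mapK M1) ?(chart_mapK M2) //;
  try by [apply: hl | apply: hr].
have [|_ ->] := nP (lsubmx h 0 0 + rsubmx h 0 0).
  by apply: pnZpD; [apply: hl | apply: hr].
by congr (_ + _); apply/rowP => i; rewrite ord1 !mxE.
Qed.

Lemma padic_translation_charts :
  translation_charts (padic_manifold p_pr) (fun x a => x + a).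
Proof.
split=> [x|x a b|_ -> x _]; rewrite ?addr0 ?addrA //.
exists 0%N => a _; split=> //=.
by apply/rowP => i; rewrite !mxE.
Qed.

End Analytic.

(** * Lie structures on groups containing Q_p *)

Section PadicIntegers.
Variables (p : nat) (p_pr : prime p).
Local Notation Zp := (padic_int p_pr).
Local Notation Qp := (padic p_pr).

Lemma residue0 n : residue (0 : Zp) n = 0%N.
Proof. by rewrite /= mod0n. Qed.

Lemma residueM (x y : Zp) n :
  residue (x * y) n = (residue x n * residue y n %% p ^ n)%N.
Proof. by []. Qed.

Lemma residue_nat m n : residue (m%:R : Zp) n = (m %% p ^ n)%N.
Proof.
elim: m => [|m IHm]; first by [].
by rewrite -addn1 natrD /= IHm modnDml modnDmr.
Qed.

Lemma residue_natX n : residue (p%:R ^+ n : Zp) n = 0%N.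
Proof. by rewrite -natrX residue_nat modnn. Qed.

Lemma natp_neq0 : p%:R != 0 :> Zp.
Proof.
apply/eqP => /(congr1 (fun x => residue x 2)).
rewrite residue0 residue_nat modn_small => [/eqP|].
  by rewrite eqn0Ngt prime_gt0.
by rewrite ltn_Pmulr ?prime_gt1 ?prime_gt0.
Qed.

Lemma natp_tofrac : p%:R = tofrac (p%:R : Zp) :> Qp.
Proof. by rewrite rmorph_nat. Qed.

Lemma tofrac_inj : injective (@tofrac Zp).
Proof. by move=> x y /eqP; rewrite tofrac_eq => /eqP. Qed.

(** A nonzero element of Z_p has a nonzero residue at some level n, whereas elements of p^n Z_p have
    residue 0 there. *)
Lemma pnZp_neq0 (x : Qp) : x != 0 -> exists n, ~ pnZp p_pr n x.
Proof.
move=> x0; apply: contrapT => /forallNP xn; case/negP: x0.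
have {}xn n : pnZp p_pr n x by apply: contrapT.
have [z _] := xn 0%N; rewrite expr0 mul1r => zx.
suff -> : x = 0 by [].
rewrite -zx; have [->|/padic_neq0[n /eqP[]]] := eqVneq z 0.
  exact: rmorph0.
have [y _] := xn n; rewrite -zx natp_tofrac -rmorphXn -rmorphM.
by move=> /tofrac_inj <-; rewrite residueM residue_natX mul0n mod0n.
Qed.

End PadicIntegers.

Section GroupManifold.
Variables (p : nat) (p_pr : prime p).
Local Notation Qp := (padic p_pr).
Variables (T : groupType) (io : Qp -> T).
Hypothesis ioD : forall a b, io (a + b) = (io a * io b)%g.
Hypothesis io_inj : injective io.
Hypothesis io_cent : forall x, exists n, forall a, pnZp p_pr n a ->
  (io a * x = x * io a)%g.

(** Off the coset of [g] the value 0 is a dummy; on it the coordinate is unique because [io] is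
    injective. *)
Definition coset_coord (g y : T) : Qp :=
  xget 0 [set a | pnZp p_pr 0 a /\ y = (g * io a)%g].

Lemma coset_coordE g a : pnZp p_pr 0 a -> coset_coord g (g * io a)%g = a.
Proof.
move=> a0; rewrite /coset_coord.
have ne : exists b, [set b | pnZp p_pr 0 b /\ (g * io a = g * io b)%g] b.
  by exists a.
by have [_ /mulgI/io_inj] := xgetPex 0 ne.
Qed.

Definition coset_chart (g : T) : chart p_pr 1 T :=
  Chart [set (g * io a)%g | a in pnZp p_pr 0]
    (fun y => const_mx (coset_coord g y)) (fun v => (g * io (v 0 0)%R)%g).

Lemma coset_chart_shift g x a : chart_dom (coset_chart g) x ->
  pnZp p_pr 0 a -> chart_dom (coset_chart g) (x * io a)%g /\
  chart_map (coset_chart g) (x * io a)%g =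
    chart_map (coset_chart g) x + const_mx a.
Proof.
move=> [b b0 <-] a0 /=; rewrite -mulgA -ioD; have ab0 := pnZpD b0 a0.
split; first by exists (b + a).
by apply/rowP => i; rewrite !mxE !coset_coordE.
Qed.

Lemma coset_chartK g x : chart_dom (coset_chart g) x ->
  chart_inv (coset_chart g) (chart_map (coset_chart g) x) = x.
Proof. by move=> [a a0 <-] /=; rewrite mxE coset_coordE. Qed.

Lemma coset_chart_invK g x (h : 'rV_1) : chart_dom (coset_chart g) x ->
  pnZp p_pr 0 (h 0 0) ->
  chart_inv (coset_chart g) (chart_map (coset_chart g) x + h) =
    (x * io (h 0 0)%R)%g.
Proof.
move=> dx h0; have [dy my] := coset_chart_shift dx h0.
rewrite -[RHS](coset_chartK dy) my; congr (chart_inv _ (_ + _)).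
by apply/rowP => i; rewrite ord1 mxE.
Qed.

Lemma io0 : io 0 = 1%g.
Proof. by apply: (mulgI (io 0)); rewrite -ioD addr0 mulg1. Qed.

Program Definition group_manifold : manifold p_pr 1 T :=
  @Manifold p p_pr 1 T (range coset_chart) _ _ _ _.
Next Obligation.
move=> x; exists (coset_chart x); first by exists x.
by exists 0; [apply: pnZp0 | rewrite io0 mulg1].
Qed.
Next Obligation. by move=> _ [g _ <-]; apply: coset_chartK. Qed.
Next Obligation.
move=> _ _ [g _ <-] [h _ <-]; apply/open_row => _ [x [gx hx] <-].
exists 0%N => v /(_ 0) v0.
have [gy my] := coset_chart_shift gx v0; have [hy _] := coset_chart_shift hx v0.
exists (x * io (v 0 0)%R)%g; rewrite // my.
by congr (_ + _); apply/rowP => i; rewrite ord1 mxE.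
Qed.
Next Obligation.
move=> _ _ [g _ <-] [h _ <-] x gx hx.
apply: (@analytic_at_affine _ _ _ _ _ _ 1%:M 0) => v /(_ 0) v0.
rewrite mulmx1 [LHS]/comp coset_chart_invK // (coset_chart_shift hx v0).2.
rewrite [in RHS]/comp coset_chartK //.
by congr (_ + _); apply/rowP => i; rewrite ord1 mxE.
Qed.

Lemma group_translation_charts :
  translation_charts group_manifold (fun x a => x * io a)%g.
Proof.
split=> [x|x a b|_ [g _ <-] x gx]; rewrite ?io0 ?mulg1 ?ioD ?mulgA //.
by exists 0%N => a a0; apply: coset_chart_shift.
Qed.

Lemma ioN a : io (- a) = (io a)^-1%g.
Proof. by apply: (mulIg (io a)); rewrite -ioD addNr io0 mulVg. Qed.

(** Either [x^-1 * y] is [io a] with [a] nonzero, or it lies outside the image of [io]. In both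
    cases the image of some p^n Z_p misses it, and the balls of that radius around [x] and [y] are
    disjoint. *)
Lemma group_hausdorff : hausdorff_space (mspace group_manifold).
Proof.
have gM := group_translation_charts.
move=> x y xy; apply: contrapT => /eqP.
rewrite -(inj_eq (mulgI x^-1%g)) mulVg => xy1.
have [n nP] : exists n, forall a, pnZp p_pr n a -> (x^-1 * y)%g <> io a.
  have [[a xya]|] := pselect (exists a, (x^-1 * y)%g = io a).
    have [|n nP] := @pnZp_neq0 _ p_pr a.
      by apply: contraNneq xy1 => a0; rewrite xya a0 io0.
    by exists n => b bn; rewrite xya => /io_inj ab; apply: nP; rewrite ab.
  by move=> /forallNP nio; exists 0%N => a _; apply: nio.
pose W z : set (mspace group_manifold) := [set (z * io a)%g | a in pnZp p_pr n].
have WP z : nbhs (z : mspace group_manifold) (W z).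
  by apply/(nbhs_shiftP gM); exists n => a an; exists a.
have [_ [[a an <-] [b bn /(canRL (mulgK _)) yx]]] := xy _ _ (WP x) (WP y).
apply: (nP (a - b)); first by apply: pnZpD => //; apply: pnZpN.
by rewrite yx -mulgA mulKg ioD ioN.
Qed.

(** For small [a], [io a] moves past [y], so x io(a) y io(b) = x y io(a + b). *)
Lemma group_mul_analytic (x y : T) :
  analytic_map2_at group_manifold group_manifold group_manifold
    (fun u v => u * v)%g x y.
Proof.
have [k kP] := io_cent y.
apply: (analytic_map2_shift (k := k) group_translation_charts) => a b ak _ /=.
by rewrite mulgA -(mulgA x) kP // ioD !mulgA.
Qed.

(** For small [a], the inverse of x io(a) is io(-a) x^-1 = x^-1 io(-a), whence the factor -1. *)
Lemma group_inv_analytic (x : T) :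
  analytic_map_at group_manifold group_manifold (fun u => u^-1)%g x.
Proof.
have [k kP] := io_cent x^-1%g.
have gM := group_translation_charts.
have c0 : pnZp p_pr 0 (-1) by exists (-1) => //; rewrite expr0 mul1r rmorphN1.
apply: (analytic_map_shift gM gM c0 (k := k)) => a /pnZpN/kP.
by rewrite mulN1r invgM -ioN.
Qed.

Definition group_lie_structure : lie_structure p_pr 1 T :=
  LieStructure group_hausdorff group_mul_analytic group_inv_analytic.

End GroupManifold.

(** Local equivariance makes [f] map small orbit balls onto orbit balls, so in charts both [f] and
    its inverse are locally translations. *)
Lemma shift_open_embedding (p : nat) (p_pr : prime p) (T T' : choiceType)
    (M : manifold p_pr 1 T) (M' : manifold p_pr 1 T') s s'
    (U : set T) (f : T -> T') x0 :
  translation_charts M s -> translation_charts M' s' -> U x0 ->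
  (forall x, U x -> exists n, forall a, pnZp p_pr n a ->
    U (s x a) /\ f (s x a) = s' (f x) a) ->
  {in U &, injective f} -> open_embedding M M' U f.
Proof.
move=> sM sM' Ux0 Uf f_inj.
(* Off the image of [U] this left inverse takes the dummy value [x0]. *)
pose g y := xget x0 [set x | U x /\ f x = y].
have gf x : U x -> g (f x) = x.
  move=> Ux; have ne : exists z, [set z | U z /\ f z = f x] z by exists x.
  by have [Ug fg] := xgetPex x0 ne; apply: f_inj; rewrite ?inE.
have c1 : pnZp p_pr 0 1 by exists 1 => //; rewrite expr0 mul1r rmorph1.
split.
- rewrite openE => x /Uf[n nP]; apply/(nbhs_shiftP sM).
  by exists n => a /nP[].
- rewrite openE => _ [x /Uf[n nP] <-]; apply/(nbhs_shiftP sM').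
  by exists n => a /nP[Us <-]; exists (s x a).
- move=> x /Uf[n nP].
  apply: (analytic_map_shift sM sM' c1 (k := n)) => a /nP[_].
  by rewrite mul1r.
exists g => x Ux; split; first exact: gf.
have [n nP] := Uf x Ux.
apply: (analytic_map_shift sM' sM c1 (k := n)) => a /nP[Us <-].
by rewrite !gf // mul1r.
Qed.

(** * Actions of colimits and amalgams *)

Section ColimitAction.
Local Open Scope group_scope.
Local Open Scope quotient_scope.
Variables (I : choiceType) (A : I -> groupType).
Variable glue : forall i j, A i -> A j -> Prop.
Local Notation G := (colimit glue).

Lemma colimit_in1 i : colimit_in glue (1 : A i) = 1.
Proof. by apply/word_eqP/word_eq_one. Qed.

Lemma colimit_rect_in (P : G -> Prop) : P 1 ->
  (forall i (x : A i) g, P g -> P (colimit_in glue x * g)) -> forall g, P g.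
Proof.
move=> P1 PM; elim/quotW => u; elim: u => [//|[i x] u IHu].
by have := PM i x _ IHu; rewrite /GRing.mul /= -[_ * _]/(cmul _ _) cmulE.
Qed.

Variables (X : Type) (act : forall i, A i -> X -> X).
Hypothesis act1 : forall i, @act i 1 =1 id.
Hypothesis actM : forall i (x y : A i), act (x * y) =1 act x \o act y.
Hypothesis act_glue : forall i j (x : A i) (y : A j),
  glue x y -> act x =1 act y.

Definition word_act (u : word A) (x : X) : X :=
  foldr (fun l => act (tagged l)) x u.

Lemma word_act_cat u v : word_act (u ++ v) =1 word_act u \o word_act v.
Proof. by move=> x; rewrite /word_act foldr_cat. Qed.

(** Each generating relation is respected by the action, so [colimit_act] does not depend on the
    representative given by [repr]. *)
Lemma word_act_eq u v : word_eq glue u v -> word_act u =1 word_act v.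
Proof.
elim=> {u v}
  [//|u v _ uv|u v w _ uv _ vw|u u' v v' _ uu _ vv|i|i x y|i j x y xy] a;
  rewrite ?uv ?vw //.
- by rewrite !word_act_cat /= uu vv.
- exact: act1.
- by rewrite /= actM.
- exact: act_glue.
Qed.

Definition colimit_act (g : G) : X -> X := word_act (repr g).

Lemma colimit_act_pi u : colimit_act (\pi_G u) =1 word_act u.
Proof. exact/word_act_eq/word_eq_repr. Qed.

Lemma colimit_act_in i (x : A i) : colimit_act (colimit_in glue x) =1 act x.
Proof. by move=> a; rewrite colimit_act_pi. Qed.

Lemma colimit_act1 : colimit_act 1 =1 id.
Proof. by move=> a; rewrite colimit_act_pi. Qed.

Lemma colimit_actM (g h : G) :
  colimit_act (g * h) =1 colimit_act g \o colimit_act h.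
Proof.
by move=> a; rewrite -[g * h]/(cmul g h) colimit_act_pi word_act_cat.
Qed.

End ColimitAction.

Section AmalgamAction.
Local Open Scope group_scope.
Variables (A1 A2 : groupType) (B : set A2) (f : A2 -> A1).
Variables (X : Type) (act1 : A1 -> X -> X) (act2 : A2 -> X -> X).
Hypothesis act1_1 : act1 1 =1 id.
Hypothesis act1M : forall x y, act1 (x * y) =1 act1 x \o act1 y.
Hypothesis act2_1 : act2 1 =1 id.
Hypothesis act2M : forall x y, act2 (x * y) =1 act2 x \o act2 y.
Hypothesis act_glue : forall b, B b -> act1 (f b) =1 act2 b.

Definition factor_act (i : bool) : amalgam_factor A1 A2 i -> X -> X :=
  if i is true then act2 else act1.

Definition amalgam_act : amalgam B f -> X -> X := colimit_act factor_act.

Lemma factor_act1 i : @factor_act i 1 =1 id.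
Proof. by case: i. Qed.

Lemma factor_actM i (x y : amalgam_factor A1 A2 i) :
  factor_act (x * y) =1 factor_act x \o factor_act y.
Proof. by case: i x y. Qed.

Lemma factor_act_glue i j (x : amalgam_factor A1 A2 i)
    (y : amalgam_factor A1 A2 j) :
  amalgam_glue B f x y -> factor_act x =1 factor_act y.
Proof. by case=> b; apply: act_glue. Qed.

Lemma amalgam_act_inl x : amalgam_act (amalgam_inl B f x) =1 act1 x.
Proof.
exact: colimit_act_in factor_act1 factor_actM factor_act_glue false x.
Qed.

Lemma amalgam_act_inr y : amalgam_act (amalgam_inr B f y) =1 act2 y.
Proof.
exact: colimit_act_in factor_act1 factor_actM factor_act_glue true y.
Qed.

Lemma amalgam_act1 : amalgam_act 1 =1 id.
Proof. exact: colimit_act1 factor_act1 factor_actM factor_act_glue. Qed.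

Lemma amalgam_actM (g h : amalgam B f) :
  amalgam_act (g * h) =1 amalgam_act g \o amalgam_act h.
Proof. exact: colimit_actM factor_act1 factor_actM factor_act_glue g h. Qed.

End AmalgamAction.

(** * Embedding of a factor into an amalgamated product *)

Section AmalgamInjective.
Local Open Scope group_scope.
Variables (A1 A2 : groupType) (B : set A2) (f : A2 -> A1).
Hypothesis B1 : B 1.
Hypothesis BM : forall x y, B x -> B y -> B (x * y).
Hypothesis BV : forall x, B x -> B x^-1.
Hypothesis fM : forall x y, B x -> B y -> f (x * y) = f x * f y.
Hypothesis f_inj : forall x y, B x -> B y -> f x = f y -> x = y.

(** The choice is made from the coset f(B) x as a set, so all elements of a coset get the same
    representative. *)
Definition rep1 (x : A1) := xget 1 [set z | exists2 b, B b & x = f b * z].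
Definition rep2 (y : A2) := xget 1 [set z | B (y * z^-1)].
Definition fac1 (x : A1) := xget 1 [set b | B b /\ x = f b * rep1 x].
Definition fac2 (y : A2) := y * (rep2 y)^-1.

Lemma amalgam_f1 : f 1 = 1.
Proof. by apply: (mulgI (f 1)); rewrite -fM // !mulg1. Qed.

Lemma fac1P x : B (fac1 x) /\ x = f (fac1 x) * rep1 x.
Proof.
have ne : exists z, [set z | exists2 b, B b & x = f b * z] z.
  by exists x; exists 1; rewrite // amalgam_f1 mul1g.
have [b Bb xb] := xgetPex 1 ne.
have ne' : exists b, [set b | B b /\ x = f b * rep1 x] b by exists b.
exact: (xgetPex 1 ne').
Qed.

Lemma fac2P y : B (fac2 y).
Proof.
have ne : exists z, [set z | B (y * z^-1)] z by exists y; rewrite /= mulgV.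
exact: (xgetPex 1 ne).
Qed.

Lemma fac2_rep2 y : fac2 y * rep2 y = y.
Proof. exact: mulgVK. Qed.

Lemma rep1M b x : B b -> rep1 (f b * x) = rep1 x.
Proof.
move=> Bb; congr (xget _ _); apply/seteqP; split=> z [c Bc /= xc].
  exists (b^-1 * c); first by apply: BM => //; apply: BV.
  rewrite fM //; last exact: BV.
  by rewrite -mulgA -xc mulgA -fM ?mulVg ?amalgam_f1 ?mul1g //; apply: BV.
by exists (b * c); [apply: BM | rewrite fM // xc mulgA].
Qed.

Lemma rep2M b y : B b -> rep2 (b * y) = rep2 y.
Proof.
move=> Bb; congr (xget _ _); apply/seteqP; split=> z /= Bz.
  by rewrite -(mulKg b (y * _)); apply: BM; [apply: BV | rewrite mulgA].
by rewrite -mulgA; apply: BM.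
Qed.

Lemma rep2_idem y : rep2 (rep2 y) = rep2 y.
Proof. by rewrite -{2}(fac2_rep2 y) rep2M //; apply: fac2P. Qed.

Lemma rep1_idem x : rep1 (rep1 x) = rep1 x.
Proof. by have [Bx {2}->] := fac1P x; rewrite rep1M. Qed.

Lemma fac1M b x : B b -> fac1 (f b * rep1 x) = b.
Proof.
move=> Bb; have [By] := fac1P (f b * rep1 x).
by rewrite rep1M // rep1_idem => /mulIg e; apply: f_inj.
Qed.

Lemma fac2M b y : B b -> fac2 (b * rep2 y) = b.
Proof. by move=> Bb; rewrite /fac2 rep2M // rep2_idem mulgK. Qed.

(* Writing x = f(b) r and s = c t with r, t representatives, the pair (x, s)
   stands for the point b t of the copy of A2 indexed by (r, c); both factors
   act by left multiplication, and the two actions agree on B. *)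
Definition coset_act (y : A2) (xs : A1 * A2) : A1 * A2 :=
  let w := y * (fac1 xs.1 * rep2 xs.2) in
  (f (fac2 w) * rep1 xs.1, fac2 xs.2 * rep2 w).

Lemma coset_actB b xs : B b -> coset_act b xs = (f b * xs.1, xs.2).
Proof.
case: xs => x s Bb; have [Bx xE] := fac1P x; have Bbx := BM Bb Bx.
rewrite /coset_act /= mulgA fac2M // rep2M // rep2_idem fac2_rep2 fM //.
by rewrite -mulgA -xE.
Qed.

Lemma coset_actM y z xs :
  coset_act (y * z) xs = coset_act y (coset_act z xs).
Proof.
case: xs => x s; rewrite /coset_act /=; set w := z * _.
have [Bw Bs] := (fac2P w, fac2P s).
rewrite (fac1M _ Bw) (rep1M _ Bw) rep1_idem (rep2M _ Bs) rep2_idem (fac2M _ Bs).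
by rewrite fac2_rep2 -[y * z * _]mulgA.
Qed.

(** The amalgam acts on [A1 * A2] through left multiplication on the first component and through
    [coset_act]. The image of [x] in the amalgam sends (1, 1) to (x, 1), which recovers [x]. *)
Lemma amalgam_inl_inj : injective (amalgam_inl B f).
Proof.
pose act1 x (xs : A1 * A2) := (x * xs.1, xs.2).
have actE x : amalgam_act act1 coset_act (amalgam_inl B f x) (1, 1) = (x, 1).
  rewrite amalgam_act_inl /act1 ?mulg1 //= =>
    [[a s]|y z [a s]|[a s]|y z xs|b Bb xs] /=.
  - by rewrite mul1g.
  - by rewrite mulgA.
  - by rewrite coset_actB // amalgam_f1 mul1g.
  - exact: coset_actM.
  - by rewrite coset_actB.
by move=> x y xy; have := actE x; rewrite xy actE => -[].
Qed.

Lemma amalgam_inlM : {morph amalgam_inl B f : x y / x * y}.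
Proof. exact: (@colimit_inM _ (amalgam_factor A1 A2) _ false). Qed.

Lemma amalgam_inrM : {morph amalgam_inr B f : x y / x * y}.
Proof. exact: (@colimit_inM _ (amalgam_factor A1 A2) _ true). Qed.

Lemma amalgam_ind (P : amalgam B f -> Prop) : P 1 ->
  (forall x g, P g -> P (amalgam_inl B f x * g)) ->
  (forall y g, P g -> P (amalgam_inr B f y * g)) -> forall g, P g.
Proof. by move=> P1 Pl Pr; apply: colimit_rect_in => // -[]. Qed.

End AmalgamInjective.

(** * The tower *)

Section Tower.
Variables (p : nat) (p_pr : prime p).
Local Notation Qp := (padic p_pr).
Local Notation tower := (tower p_pr).

Fixpoint first_copy n (x : Qp) : tower n :=
  if n is m.+1 then tower_inc (first_copy m x) else x.

Lemma tower_incM n : {morph @tower_inc p p_pr n : x y / (x * y)%g}.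
Proof. exact: amalgam_inlM. Qed.

Lemma first_copyD n a b :
  first_copy n (a + b) = (first_copy n a * first_copy n b)%g.
Proof. by elim: n => [//|n /= ->]; apply: tower_incM. Qed.

Lemma last_copyD n a b :
  last_copy n (a + b : Qp) = (last_copy n a * last_copy n b)%g.
Proof. by case: n => [//|n]; apply: amalgam_inrM. Qed.

Lemma tower_inc_last n (a : Qp) : pnZp p_pr n a ->
  tower_inc (last_copy n a) = last_copy n.+1 a.
Proof. by move=> an; apply: colimit_in_glue. Qed.

(** Copies n and n+1 are glued along p^n Z_p, which contains p^(n+1) Z_p, so the identifications
    chain down to the first copy. *)
Lemma last_copy_first n a : pnZp p_pr n a -> last_copy n a = first_copy n a.
Proof.
elim: n => [//|n IHn] aSn; have an := pnZp_le (leqnSn n) aSn.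
by rewrite /= -IHn // tower_inc_last.
Qed.

(** One exponent better than [last_copy_first], because the last gluing in G_(n+1) is along p^n Z_p.
    This is the subgroup whose embedding [standard_lie_structures] requires to be open. *)
Lemma last_copyS_first n a : pnZp p_pr n a ->
  last_copy n.+1 a = first_copy n.+1 a.
Proof. by move=> an; rewrite -tower_inc_last // last_copy_first. Qed.

(** The gluing map must be injective on p^n Z_p, where it agrees with [first_copy n]; so injectivity
    of [first_copy] and of [tower_inc] climb the tower together. *)
Lemma tower_inc_inj_first n : injective (first_copy n) ->
  injective (@tower_inc p p_pr n).
Proof.
move=> n_inj; apply: amalgam_inl_inj.
- exact: pnZp0.
- exact: pnZpD.
- exact: pnZpN.
- by move=> a b _ _; apply: last_copyD.
by move=> a b an bn; rewrite -!/(last_copy n _) !last_copy_first // => /n_inj.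
Qed.

Lemma first_copy_inj n : injective (first_copy n).
Proof.
elim: n => [//|n IHn] a b /tower_inc_inj_first ab; exact/IHn/ab.
Qed.

Lemma tower_inc_inj n : injective (@tower_inc p p_pr n).
Proof. exact/tower_inc_inj_first/first_copy_inj. Qed.

(** Generators from the previous stage commute with [a] by induction; generators from the new copy
    do so because [a] also lies in that commutative copy. *)
Lemma first_copy_central n a (x : tower n) : pnZp p_pr n a ->
  (first_copy n a * x = x * first_copy n a)%g.
Proof.
elim: n x => [|n IHn] x an; first exact: addrC.
have {}an := pnZp_le (leqnSn n) an.
elim/amalgam_ind: x => [|x g Pg|y g Pg]; first by rewrite mulg1 mul1g.
  rewrite mulgA -[amalgam_inl _ _ _]/(tower_inc x) -tower_incM IHn //.
  by rewrite tower_incM -!mulgA Pg.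
rewrite mulgA -[amalgam_inr _ _ _]/(last_copy n.+1 y) -last_copyS_first //.
rewrite -last_copyD addrC last_copyD -!mulgA; congr (_ * _)%g.
by rewrite last_copyS_first.
Qed.

End Tower.

(** * The direct limit of the tower and its Lie group structure *)

Section TowerLimit.
Variables (p : nat) (p_pr : prime p).
Local Notation Qp := (padic p_pr).
Local Notation tower := (tower p_pr).

(** Transport along an equality of indices; the dummy value 1 for distinct indices keeps the map
    multiplicative. *)
Definition tower_cast m n (x : tower m) : tower n :=
  if eq_comparable m n is left e then ecast n (tower n) e x else 1%g.

Lemma tower_castK n (x : tower n) : tower_cast n x = x.
Proof.
rewrite /tower_cast; case: eq_comparable => // e.
by rewrite (eq_irrelevance e erefl).
Qed.

Lemma tower_castM m n : {morph @tower_cast m n : x y / (x * y)%g}.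
Proof.
rewrite /tower_cast; case: eq_comparable => [e|_] x y; last by rewrite mulg1.
by case: _ / e.
Qed.

(* Constant if n < m. *)
Fixpoint tower_up m n (x : tower m) : tower n :=
  if n is k.+1 then
    if (m <= k)%N then tower_inc (tower_up k x) else tower_cast k.+1 x
  else tower_cast 0 x.

Lemma tower_upnn n (x : tower n) : tower_up n x = x.
Proof. by case: n x => [|n] x; rewrite /= ?ltnn tower_castK. Qed.

Lemma tower_upS m n (x : tower m) : (m <= n)%N ->
  tower_up n.+1 x = tower_inc (tower_up n x).
Proof. by rewrite /= => ->. Qed.

Lemma tower_upM m n : {morph @tower_up m n : x y / (x * y)%g}.
Proof.
elim: n => [|n IHn] x y; first exact: (@tower_castM m 0).
rewrite /=; case: leqP => _; rewrite ?IHn; first exact: tower_incM.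
exact: (@tower_castM m n.+1).
Qed.

Lemma tower_up1 m n : tower_up n (1 : tower m)%g = 1%g.
Proof.
by apply: (mulgI (tower_up n (1 : tower m)%g)); rewrite -tower_upM !mulg1.
Qed.

Lemma tower_up_inc m n (x : tower m) : (m < n)%N ->
  tower_up n (tower_inc x) = tower_up n x.
Proof.
elim: n => // n IHn; rewrite ltnS leq_eqVlt => /predU1P[mn|mn].
  by rewrite -mn tower_upnn tower_upS // tower_upnn.
by rewrite !tower_upS ?IHn // ltnW.
Qed.

Lemma tower_up_inj m n : (m <= n)%N -> injective (@tower_up m n).
Proof.
elim: n => [|n IHn]; first by rewrite leqn0 => /eqP -> x y; rewrite !tower_upnn.
rewrite leq_eqVlt => /predU1P[<- x y|mn x y]; first by rewrite !tower_upnn.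
by rewrite !tower_upS // => /tower_inc_inj/IHn; apply.
Qed.

Definition tower_word n (u : word tower) : tower n -> tower n :=
  word_act (fun m x y => tower_up n x * y)%g u.

(** Evaluation in G_n sends letters of level above n to 1 and so may violate gluing relations of
    high level. A derivation uses finitely many relations, hence the bound [N]. *)
Lemma tower_word_eq u v : word_eq (@tower_glue p p_pr) u v ->
  exists N, forall n, (N <= n)%N -> @tower_word n u =1 @tower_word n v.
Proof.
rewrite /tower_word.
elim=> {u v}
  [u|u v _ [N uv]|u v w _ [N uv] _ [N' vw]|u u' v v' _ [N uu] _ [N' vv]
  |i|i x y|_ _ _ _ [i x]].
- by exists 0%N.
- by exists N => n /uv e x.
- exists (maxn N N') => n; rewrite geq_max => /andP[/uv e /vw e'] x.
  by rewrite e e'.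
- exists (maxn N N') => n; rewrite geq_max => /andP[/uu e /vv e'] x.
  by rewrite !word_act_cat /= e e'.
- by exists 0%N => n _ x /=; rewrite tower_up1 mul1g.
- by exists 0%N => n _ z /=; rewrite tower_upM mulgA.
- by exists i.+1 => n ni z /=; rewrite tower_up_inc.
Qed.

Lemma tower_in_inj n : injective (@tower_in p p_pr n).
Proof.
move=> x y /word_eqP/tower_word_eq[N /(_ (maxn N n) (leq_maxl N n) 1%g)].
by rewrite /tower_word /= !mulg1; apply: tower_up_inj; apply: leq_maxr.
Qed.

Lemma tower_inM n : {morph @tower_in p p_pr n : x y / (x * y)%g}.
Proof. exact: colimit_inM. Qed.

Lemma tower_in_inc n (x : tower n) : tower_in (tower_inc x) = tower_in x.
Proof. by apply/esym/colimit_in_glue. Qed.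

Definition first_in (x : Qp) : tower_limit p_pr := tower_in (first_copy 0 x).

Lemma first_inE n x : first_in x = tower_in (first_copy n x).
Proof. by elim: n => [//|n ->]; rewrite -tower_in_inc. Qed.

Lemma first_inD a b : first_in (a + b) = (first_in a * first_in b)%g.
Proof. by rewrite /first_in first_copyD tower_inM. Qed.

Lemma first_in_inj : injective first_in.
Proof. by move=> a b /tower_in_inj. Qed.

Lemma first_in_central (x : tower_limit p_pr) :
  exists n, forall a, pnZp p_pr n a -> (first_in a * x = x * first_in a)%g.
Proof.
elim/colimit_rect_in: x => [|n x g [m gP]].
  by exists 0%N => a _; rewrite mulg1 mul1g.
exists (maxn m n) => a amn.
have am := pnZp_le (leq_maxl m n) amn; have an := pnZp_le (leq_maxr m n) amn.
have {}gP := gP a am; rewrite -[colimit_in _ x]/(tower_in x).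
rewrite -(mulgA (tower_in x)) -gP !mulgA; congr (_ * _)%g.
by rewrite (first_inE n) -!tower_inM first_copy_central.
Qed.

Lemma first_copy_centralE n (x : tower n) :
  exists k, forall a, pnZp p_pr k a ->
    (first_copy n a * x = x * first_copy n a)%g.
Proof. by exists n => a; apply: first_copy_central. Qed.

(** All the groups carry the translation action of the one first copy, and the maps involved
    intertwine these actions near each point, so [shift_open_embedding] applies. *)
Lemma standard_lie_structures_exist :
  exists (L : forall n, lie_structure p_pr 1 (tower n))
    (Lim : lie_structure p_pr 1 (tower_limit p_pr)),
  standard_lie_structures L Lim.
Proof.
pose LM n := group_translation_charts (@first_copyD p p_pr n)
  (@first_copy_inj p p_pr n).
have LimM := group_translation_charts first_inD first_in_inj.
have QpM := padic_translation_charts p_pr.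
exists (fun n => group_lie_structure (@first_copyD p p_pr n)
  (@first_copy_inj p p_pr n) (@first_copy_centralE n)).
exists (group_lie_structure first_inD first_in_inj first_in_central).
split=> [|n|n].
- apply: (shift_open_embedding (x0 := 0) QpM (LM 0%N)) => //.
  by move=> x _; exists 0%N.
- apply: (shift_open_embedding (x0 := 0) QpM (LM n.+1)).
  + exact: pnZp0.
  + move=> x xn; exists n => a an; split; first exact: pnZpD.
    by rewrite last_copyD -last_copyS_first.
  + move=> x y; rewrite !inE => xn yn.
    by rewrite !last_copyS_first // => /first_copy_inj.
- apply: (shift_open_embedding (x0 := 1%g) (LM n) LimM) => //.
  + move=> x _; exists 0%N => a _; split=> //.
    by rewrite (first_inE n) tower_inM.
  + by move=> x y _ _; apply: tower_in_inj.
Qed.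

End TowerLimit.

(** * Divisible elements of Q_p *)

Lemma fraction_num_den (R : idomainType) (x : {fraction R}) :
  exists n d : R, d != 0 /\ x * tofrac d = tofrac n.
Proof.
elim/quotW: x => r; exists (frac r).1, (frac r).2.
split; first exact: denom_ratioP.
unlock tofrac; rewrite -[LHS]FracField.pi_mul; apply/eqmodP => /=.
rewrite FracField.equivfE /FracField.mulf.
by rewrite !numden_Ratio ?mulf_neq0 ?oner_neq0 ?denom_ratioP // !mulr1 mulrC.
Qed.

Section PadicDivisible.
Variables (p : nat) (p_pr : prime p).
Local Notation Zp := (padic_int p_pr).
Local Notation Qp := (padic p_pr).

Lemma residue1S (x : Zp) n : (residue x n.+1 %% p = residue x 1)%N.
Proof. by have := residue_add x 1 n; rewrite residue_mod expn1. Qed.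

Lemma residue1_mod (x : Zp) : (residue x 1 %% p = residue x 1)%N.
Proof. by have := residue_mod x 1; rewrite expn1. Qed.

Lemma residueX (x : Zp) n m : residue (x ^+ n) m = (residue x m ^ n %% p ^ m)%N.
Proof.
elim: n => [//|n IHn].
by rewrite exprS residueM IHn modnMmr expnS.
Qed.

Lemma residue1_eq0 (x : Zp) : residue x 1 = 0%N -> exists y, x = p%:R * y.
Proof.
move=> x1; have px n : (p %| residue x n.+1)%N by rewrite /dvdn residue1S x1.
have p0 := prime_gt0 p_pr.
(* Division by p loses one digit: residue n of the quotient is read off from residue n+1 of [x]. *)
have fP n : (residue x n.+2 %/ p = residue x n.+1 %/ p %[mod p ^ n])%N.
  apply/eqP; rewrite -(eqn_pmul2l p0) !muln_modr -!expnS !(mulnC p) !divnK //.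
  by rewrite residueS.
exists (padic_of p_pr fP); apply: padic_intP => n.
rewrite residueM residue_nat /=.
rewrite modnMml modnMmr mulnC divnK // residueS.
by rewrite residue_mod.
Qed.

(** Induction on a level [m] at which the residue is nonzero: dividing by p lowers it by one. *)
Lemma padic_int_factor (x : Zp) : x != 0 ->
  exists n y, x = p%:R ^+ n * y /\ residue y 1 != 0%N.
Proof.
move=> /padic_neq0[m]; elim: m x => [|m IHm] x xm.
  by move: xm; rewrite -(residue_mod x 0) modn1.
have [x1|] := eqVneq (residue x 1) 0%N; last by exists 0%N, x; rewrite mul1r.
have [y xy] := residue1_eq0 x1.
have [|n [z [yz z1]]] := IHm y.
  apply: contraNneq xm => ym; rewrite xy residueM residue_nat modnMml expnS.
  by rewrite -muln_modr residueS ym mod0n muln0.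
by exists n.+1, z; rewrite xy yz exprS mulrA.
Qed.

Lemma padic_factor_uniq i j (x y : Zp) :
  residue x 1 != 0%N -> residue y 1 != 0%N ->
  p%:R ^+ i * x = p%:R ^+ j * y -> i = j /\ x = y.
Proof.
wlog ij : i j x y / (i <= j)%N => [wl|] x1 y1.
  case/orP: (leq_total i j) => [ij|ji]; first exact: wl.
  by move=> /esym/(wl _ _ _ _ ji y1 x1)[].
rewrite -(subnKC ij) exprD -mulrA => /mulfI.
move=> /(_ (expf_neq0 _ (natp_neq0 p_pr))).
case: (j - i)%N => [|k] e; first by rewrite addn0 e mul1r.
case/eqP: x1.
by rewrite e exprS -mulrA residueM residue_nat expn1 modnn mul0n mod0n.
Qed.

Lemma padic_euler (x : Zp) m k : residue x 1 != 0%N ->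
  residue (x ^+ (totient (p ^ m) * k)) m = (1 %% p ^ m)%N.
Proof.
move=> x1; rewrite residueX expnM -modnXm Euler_exp_totient.
  by rewrite modnXm exp1n.
case: m => [|m]; first by rewrite coprimen1.
rewrite coprime_pexpr // coprime_sym prime_coprime //.
by rewrite /dvdn residue1S.
Qed.

Lemma padic_int_pX_neq0 n (y : Zp) :
  residue y 1 != 0%N -> p%:R ^+ n * y != 0.
Proof.
move=> y1; rewrite mulf_neq0 ?expf_neq0 ?natp_neq0 //.
by apply: contraNneq y1 => ->; rewrite residue0.
Qed.

(** This is x = p^(i-j) a / b with units a and b; denominators are cleared so that exponents stay
    natural numbers. *)
Lemma padic_factor (x : Qp) : x != 0 -> exists i j (a b : Zp),
  [/\ residue a 1 != 0%N, residue b 1 != 0%N &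
    x * tofrac (p%:R ^+ j * b) = tofrac (p%:R ^+ i * a)].
Proof.
move=> x0; have [n [d [d0 xd]]] := fraction_num_den x.
have n0 : n != 0 by rewrite -tofrac_eq0 -xd mulf_neq0 ?tofrac_eq0.
have [i [a [na a1]]] := padic_int_factor n0.
have [j [b [db b1]]] := padic_int_factor d0.
by exists i, j, a, b; rewrite -na -db.
Qed.

(** An N-th power has valuation divisible by N, and its unit part is 1 modulo p^m if the totient of
    p^m divides N. A large N forces valuation 0, and letting m vary forces the unit part to be 1. *)
Lemma padic_divisible (u : Qp) : u != 0 ->
  (forall n, (0 < n)%N -> exists v, u = v ^+ n) -> u = 1.
Proof.
move=> u0 ndiv; have [i [j [a [b [a1 b1 uab]]]]] := padic_factor u0.
have key m : i = j /\ residue a m = residue b m.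
  (* The totient makes N-th powers of units trivial modulo p^m; the factor i+j+1 makes N exceed both
     exponents. *)
  pose N := (totient (p ^ m) * (i + j).+1)%N.
  have Ngt : (i + j < N)%N.
    by rewrite leq_pmull // totient_gt0 expn_gt0 prime_gt0.
  have [v uv] := ndiv N (leq_ltn_trans (leq0n _) Ngt).
  have v0 : v != 0.
    apply: contraNneq u0 => v0.
    by rewrite uv v0 expr0n gtn_eqF // (leq_ltn_trans _ Ngt).
  have [k [l [c [d [c1 d1 vcd]]]]] := padic_factor v0.
  have XN1 (x : Zp) : residue x 1 != 0%N -> residue (x ^+ N) 1 != 0%N.
    move=> x1; rewrite residueX expn1 -/(dvdn _ _) Euclid_dvdX //.
    by rewrite /dvdn residue1_mod negb_and x1.
  have M1 (x y : Zp) : residue x 1 != 0%N -> residue y 1 != 0%N ->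
      residue (x * y) 1 != 0%N.
    move=> x1 y1; rewrite residueM expn1 -/(dvdn _ _) Euclid_dvdM //.
    by rewrite /dvdn !residue1_mod negb_or x1.
  have := congr1 (fun z => z ^+ N * tofrac (p%:R ^+ j * b)) vcd.
  rewrite /= exprMn -uv mulrAC uab -!tofracXn -!tofracM => /tofrac_inj.
  rewrite !exprMn -!exprM (mulrACA (p%:R ^+ i)) (mulrACA (p%:R ^+ (k * N))).
  rewrite -!exprD.
  move=> /padic_factor_uniq[]; rewrite ?M1 ?XN1 // => eij eab.
  split.
    (* From i + l N = k N + j follows i = j modulo N, and both are below N. *)
    have := congr1 (modn^~ N) eij; rewrite /= modnMDl addnC modnMDl.
    by rewrite !modn_small //; apply: leq_ltn_trans Ngt;
      [apply: leq_addl | apply: leq_addr].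
  have := congr1 (fun x => residue x m) eab; rewrite !residueM !padic_euler //.
  by rewrite modnMmr modnMml muln1 mul1n !residue_mod.
have [ij _] := key 0%N.
have ab : a = b by apply: padic_intP => m; have [] := key m.
apply: (@mulIf _ (tofrac (p%:R ^+ j * b))); last by rewrite mul1r uab ij ab.
by rewrite tofrac_eq0 padic_int_pX_neq0.
Qed.

Lemma padic_natr_neq0 n : (0 < n)%N -> n%:R != 0 :> Qp.
Proof.
move=> n0; rewrite -(rmorph_nat (@tofrac Zp)) tofrac_eq0.
apply/eqP => /(congr1 (fun x => residue x n)); rewrite residue0 residue_nat.
by rewrite modn_small => [nn|]; [rewrite nn in n0 | apply/ltn_expl/prime_gt1].
Qed.

(** Q_p is divisible, so each value of [h] is an n-th power for every n > 0. *)
Lemma padic_char_trivial (h : Qp -> Qp) :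
  {morph h : x y / x + y >-> x * y} -> (forall x, h x != 0) ->
  forall x, h x = 1.
Proof.
move=> hD h0 x; apply: padic_divisible => // n n0; exists (h (x / n%:R)).
have h1 : h 0 = 1 by apply: (mulfI (h0 0)); rewrite -hD addr0 mulr1.
have hMn y k : h (y *+ k) = h y ^+ k.
  by elim: k => [//|k IHk]; rewrite mulrS exprS hD IHk.
by rewrite -hMn -[_ *+ n]mulr_natr divfK ?padic_natr_neq0.
Qed.

End PadicDivisible.

(** * The obstruction *)

Section TowerAction.
Variables (p : nat) (p_pr : prime p).
Local Notation Qp := (padic p_pr).
Variables (X : Type) (act : nat -> Qp -> X -> X).
Hypothesis act0 : forall n, act n 0 =1 id.
Hypothesis actD : forall n a b, act n (a + b) =1 act n a \o act n b.
Hypothesis act_glue : forall n a, pnZp p_pr n a -> act n a =1 act n.+1 a.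

Fixpoint tower_act n : tower p_pr n -> X -> X :=
  if n is m.+1 then
    @amalgam_act _ (padic_group p_pr) (pnZp p_pr m) (@last_copy p p_pr m) X
      (@tower_act m) (act m.+1)
  else act 0.

(** The three claims go together: the compatibility needed for an action of G_(n+1) comes from the
    formula for the last copy of G_n. *)
Lemma tower_actP n : [/\ tower_act (1%g : tower p_pr n) =1 id,
  forall x y : tower p_pr n, tower_act (x * y)%g =1 tower_act x \o tower_act y &
  forall a : Qp, tower_act (last_copy n a) =1 act n a].
Proof.
elim: n => [|n [IH1 IHM IHl]]; first by split=> // *; [apply: act0|apply: actD].
have glueP b : pnZp p_pr n b -> tower_act (last_copy n b) =1 act n.+1 b.
  by move=> bn x; rewrite IHl act_glue.
split=> [|x y|a].
- exact: (amalgam_act1 IH1 IHM (act0 n.+1) (actD n.+1) glueP).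
- exact: (amalgam_actM IH1 IHM (act0 n.+1) (actD n.+1) glueP).
- exact: (amalgam_act_inr IH1 IHM (act0 n.+1) (actD n.+1) glueP).
Qed.

Lemma tower_act_inc n (x : tower p_pr n) :
  tower_act (tower_inc x) =1 tower_act x.
Proof.
have [IH1 IHM IHl] := tower_actP n.
have glueP b : pnZp p_pr n b -> tower_act (last_copy n b) =1 act n.+1 b.
  by move=> bn z; rewrite IHl act_glue.
exact: (amalgam_act_inl IH1 IHM (act0 n.+1) (actD n.+1) glueP).
Qed.

Definition limit_act : tower_limit p_pr -> X -> X := colimit_act tower_act.

Lemma limit_actM g h : limit_act (g * h)%g =1 limit_act g \o limit_act h.
Proof.
apply: colimit_actM => [n|n x y|_ _ _ _ [n x]].
- by have [] := tower_actP n.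
- by have [_ + _] := tower_actP n; apply.
- by move=> z; rewrite tower_act_inc.
Qed.

Lemma limit_act_last n (a : Qp) :
  limit_act (tower_in (last_copy n a)) =1 act n a.
Proof.
have [_ _ actE] := tower_actP n; move=> z; rewrite -actE.
apply: colimit_act_in => [m|m x y|_ _ _ _ [m x]].
- by have [] := tower_actP m.
- by have [_ + _] := tower_actP m; apply.
- by move=> w; rewrite tower_act_inc.
Qed.

End TowerAction.

(** The copies of Q_p generate the limit; the case of 1 is contained in that of the copies, as the
    image of 0. *)
Lemma tower_ind (p : nat) (p_pr : prime p) (P : tower_limit p_pr -> Prop) :
  (forall g h, P g -> P h -> P (g * h)%g) ->
  (forall n a, P (tower_in (last_copy n a))) -> forall g, P g.
Proof.
move=> PM Pl; have P1 : P 1%g.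
  by rewrite -(colimit_in1 (@tower_glue p p_pr) 0%N); apply: (Pl 0%N 0).
have Pin n (x : tower p_pr n) : P (tower_in x).
  elim: n x => [|n IHn] x; first exact: (Pl 0%N x).
  elim/amalgam_ind: x => [|x g Pg|y g Pg].
  - by rewrite [tower_in _]colimit_in1.
  - rewrite tower_inM -[amalgam_inl _ _ _]/(tower_inc x) tower_in_inc.
    exact: PM.
  - by rewrite tower_inM; apply: PM => //; apply: (Pl n.+1).
by elim/colimit_rect_in => [//|n x g Pg]; apply: PM => //; apply: Pin.
Qed.

Section NoncommutingConjugates.
Variables (p : nat) (p_pr : prime p).
Local Notation Qp := (padic p_pr).

Lemma pnZp_inv_p k : ~ pnZp p_pr k p%:R^-1.
Proof.
move=> /(pnZp_le (leq0n k))[z _]; rewrite expr0 mul1r natp_tofrac => zp.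
have := congr1 ( *%R (tofrac p%:R)) zp; rewrite divff ?tofrac_eq0 ?natp_neq0 //.
rewrite -rmorphM -(rmorph1 (@tofrac (padic_int p_pr))) => /tofrac_inj.
move=> /(congr1 (fun x => residue x 1)).
rewrite residueM residue_nat expn1 modnn mul0n mod0n /=.
by rewrite expn1 modn_small // prime_gt1.
Qed.

Lemma pnZp_pX k : pnZp p_pr k (p%:R ^+ k) /\ ~ pnZp p_pr k.+1 (p%:R ^+ k).
Proof.
have p1 : p%:R != 0 :> Qp by rewrite natp_tofrac tofrac_eq0 natp_neq0.
have p0 := expf_neq0 k p1.
split; first by exists 1; rewrite ?rmorph1 ?mulr1.
case=> z _; rewrite exprSr -mulrA -[RHS]mulr1 => /(mulfI p0) pz.
apply: (@pnZp_inv_p 0); exists z => //; rewrite expr0 mul1r.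
by apply: (mulfI p1); rewrite pz divff.
Qed.

(** * Two actions of Q_p that agree on a subgroup *)

Section Shear.
Variable B : set Qp.
Hypothesis B0 : B 0.
Hypothesis BD : forall x y, B x -> B y -> B (x + y).
Hypothesis BN : forall x, B x -> B (- x).

(* [shear] is the conjugate of [translate] by (y, m) |-> (y, m + ind y); as
   [ind] is B-periodic, the two agree on B. *)
Definition ind (y : Qp) : int := (`[< B y >] : nat)%:Z.
Definition translate (a : Qp) (ym : Qp * int) := (ym.1 + a, ym.2).
Definition shear (a : Qp) (ym : Qp * int) :=
  (ym.1 + a, ym.2 + ind ym.1 - ind (ym.1 + a)).

Lemma translate0 : translate 0 =1 id.
Proof. by case=> y m; rewrite /translate addr0. Qed.

Lemma translateD a b : translate (a + b) =1 translate a \o translate b.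
Proof. by case=> y m; rewrite /translate /= addrA addrAC. Qed.

Lemma shear0 : shear 0 =1 id.
Proof. by case=> y m; rewrite /shear addr0 addrK. Qed.

Lemma shearD a b : shear (a + b) =1 shear a \o shear b.
Proof.
by case=> y m; rewrite /shear /= subrK addrA (addrAC y).
Qed.

Lemma ind_in y : B y -> ind y = 1.
Proof. by move=> By; rewrite /ind asboolT. Qed.

Lemma ind_notin y : ~ B y -> ind y = 0.
Proof. by move=> By; rewrite /ind asboolF. Qed.

Lemma shear_translate a : B a -> translate a =1 shear a.
Proof.
move=> Ba [y m]; rewrite /shear /translate /=; congr pair.
have [By|nBy] := pselect (B y).
  by rewrite !ind_in ?addrK //; apply: BD.
rewrite !ind_notin ?addrK ?subrr // => /BD/(_ (BN Ba)).
by rewrite addrK.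
Qed.

Lemma shear_conj_noncomm z t : ~ B z -> ~ B t -> ~ B (t + z) -> ~ B (t - z) ->
  ~ (shear t \o translate z \o shear (- t)) \o translate z =1
    translate z \o (shear t \o translate z \o shear (- t)).
Proof.
(* Both sides are compared at (-z, 0). On the left [shear (- t)] starts at 0, inside [B], which
   yields second component 1; on the right [shear t] ends at 0, which yields -1. All other points at
   which [ind] is evaluated lie outside [B]. *)
move=> Bz Bt Btz Bzt /(_ (- z, 0)) /(congr1 snd) /=.
have BNn x : ~ B x -> ~ B (- x) by move=> Bx /BN; rewrite opprK.
rewrite addNr !add0r [- z - t + z]addrAC addNr add0r addNr.
rewrite [- t + z + t]addrAC addNr add0r -opprD [- t + z]addrC -[z - t]opprB.
rewrite (ind_in B0) !ind_notin //; try exact: BNn.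
  by rewrite addrC; apply: BNn.
Qed.

End Shear.

End NoncommutingConjugates.

Section Obstruction.
Variables (p : nat) (p_pr : prime p).
Local Notation Qp := (padic p_pr).
Local Notation G := (tower_limit p_pr).

Definition copy n (a : Qp) : G := tower_in (last_copy n a).

Lemma copyD n a b : copy n (a + b) = (copy n a * copy n b)%g.
Proof. by rewrite /copy last_copyD tower_inM. Qed.

Lemma copy0 n : copy n 0 = 1%g.
Proof. by apply: (mulgI (copy n 0)); rewrite -copyD addr0 mulg1. Qed.

Lemma copyN n a : copy n (- a) = (copy n a)^-1%g.
Proof. by apply: (mulIg (copy n a)); rewrite -copyD addNr copy0 mulVg. Qed.

(** With [B] = p^(k+1) Z_p, the element [z] = p^k is not in [B], and [t] = 1/p is not in p^k Z_p, so
    [t], [t + z] and [t - z] avoid [B] as [shear_conj_noncomm] demands. *)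
Lemma abelian_normal_avoids_first (Z : normal_subgroup G) k :
  (forall x y, nsub_set Z x -> nsub_set Z y -> (x * y = y * x)%g) ->
  ~ nsub_set Z (copy 0 (p%:R ^+ k)).
Proof.
set z := p%:R ^+ k; move=> Zab Zz; pose t : Qp := p%:R^-1.
pose B := pnZp p_pr k.+1.
have B0 : B 0 := pnZp0 p_pr k.+1.
have BD := @pnZpD p p_pr k.+1; have BN := @pnZpN p p_pr k.+1.
(* Copies k+1 and k+2 are glued exactly along [B], so switching from [translate] to [shear] between
   them respects the gluing. *)
pose act n := if (n <= k.+1)%N then @translate _ p_pr else @shear _ p_pr B.
have act0 n : act n 0 =1 id.
  by rewrite /act; case: ifP => _; [apply: translate0 | apply: shear0].
have actD n a b : act n (a + b) =1 act n a \o act n b.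
  by rewrite /act; case: ifP => _; [apply: translateD | apply: shearD].
have actG n a : pnZp p_pr n a -> act n a =1 act n.+1 a.
  by rewrite /act; have [nk|kn|->] := ltngtP n k.+1;
    last exact: shear_translate.
have actE n a : limit_act act (copy n a) =1 act n a.
  exact: (limit_act_last act0 actD actG).
have actM g h : limit_act act (g * h)%g =1 limit_act act g \o limit_act act h.
  exact: (limit_actM act0 actD actG).
have [z_k z_k1] := pnZp_pX p_pr k.
have tz a : pnZp p_pr k a -> ~ B (t + a).
  move=> ak /(pnZp_le (leqnSn k))/pnZpD/(_ (pnZpN ak)); rewrite addrK.
  exact: pnZp_inv_p.
apply: (@shear_conj_noncomm _ p_pr B B0 BN z t) => //.
- exact: pnZp_inv_p.
- exact: tz.
- by apply/tz/pnZpN.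
(* As [x ^ y] is y^-1 x y, conjugating by the element of [- t] produces
   [shear t \o translate z \o shear (- t)]. *)
move=> ym; have := nsubJ (copy k.+2 (- t)) Zz => /Zab/(_ Zz).
rewrite /conjg -copyN opprK => /(congr1 (fun g => limit_act act g ym)).
do !rewrite actM /=; rewrite !actE.
by rewrite /act ltnn leq0n.
Qed.

Local Open Scope quotient_scope.

Lemma linear_quotient_trivial (K : normal_subgroup G) :
  isomorphic_to_subgroup (quotient_group K) (GL Qp 1) -> forall g, nsub_set K g.
Proof.
move=> [S [_ _ [f [fM [_ f_inj _]]]]].
have f1 : f 1%g = 1%g by apply: (mulgI (f 1%g)); rewrite -fM !mulg1.
elim/tower_ind => [g h|n a]; first exact: nsubM.
(* The entry of an invertible 1 x 1 matrix: a character of the n-th copy. *)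
pose h x : Qp := val (f (\pi_(quotient_group K) (copy n x))) 0 0.
have h0 x : h x != 0.
  have := valP (f (\pi_(quotient_group K) (copy n x))).
  by rewrite /= unitmxE det_mx11 unitfE.
have hD : {morph h : x y / x + y >-> x * y}.
  by move=> x y; rewrite /h copyD -qmulE fM /= mxE big_ord1.
have ha := padic_char_trivial hD h0 a.
suff : \pi_(quotient_group K) 1%g = \pi_(quotient_group K) (copy n a).
  by move/eqP/same_cosetP; rewrite invg1 mul1g.
apply: f_inj; rewrite ?inE //; rewrite f1; apply/val_inj/matrixP => i j.
by rewrite !ord1 [RHS]ha mxE.
Qed.

Lemma tower_limit_not_abelian_discrete_linear
    (L : forall n, lie_structure p_pr 1 (tower p_pr n))
    (Lim : lie_structure p_pr 1 G) :
  standard_lie_structures L Lim -> ~ abelian_discrete_linear Lim.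
Proof.
move=> [emb0 _ emb] [Z [K [ZK _ Zab KZ /linear_quotient_trivial Kall]]].
(* Discreteness of K/Z is applied to the trivial coset [Z]; as K is the whole group, [Z] equals the
   open set [U]. *)
have [//|a z Za Zz|U oU ZU] := KZ Z; first exact: nsubM.
(* Continuity at 0 of Q_p -> G_0 -> G pulls [U] back to a neighbourhood of 0, which contains some
   p^k. *)
have [_ _ /(_ 0 I)[c0 _] _] := emb0.
have [_ _ /(_ (last_copy 0 (0 : Qp)) I)[c1 _] _] := emb 0%N.
have U1 : U (tower_in (last_copy 0 (0 : Qp))).
  have : nsub_set Z 1%g := nsub1 Z.
  by rewrite -[nsub_set Z]/(Z : set _) ZU -[tower_in _]/(copy 0 0) copy0 => -[].
have := c0 _ (c1 _ (open_nbhs_nbhs (conj oU U1))).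
move=> /(nbhs_shiftP (padic_translation_charts p_pr))[k /(_ (p%:R ^+ k))].
have [pk _] := pnZp_pX p_pr k; move=> /(_ pk) /=; rewrite add0r => Uk.
apply: (@abelian_normal_avoids_first Z k Zab).
by rewrite -[nsub_set Z]/(Z : set _) ZU; split.
Qed.

End Obstruction.

Theorem mainTheorem2 (p : nat) (p_pr : prime p) :
  ~ (forall (d : nat) (G : groupType) (L : lie_structure p_pr d G),
       abelian_discrete_linear L) /\
  (exists (L : forall n : nat, lie_structure p_pr 1 (tower p_pr n))
          (Lim : lie_structure p_pr 1 (tower_limit p_pr)),
      standard_lie_structures L Lim) /\
  (forall (L : forall n : nat, lie_structure p_pr 1 (tower p_pr n))
          (Lim : lie_structure p_pr 1 (tower_limit p_pr)),
      standard_lie_structures L Lim -> ~ abelian_discrete_linear Lim).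
Proof.
have [L [Lim LLim]] := standard_lie_structures_exist p_pr.
have notLim := tower_limit_not_abelian_discrete_linear.
split; first by move=> all; apply: notLim LLim (all _ _ _).
by split; [exists L, Lim | apply: notLim].
Qed.
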